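(* Assume $\inf_{x\in\mathbb R}V''(x)>0$. Then for every integer $n\ge1$, $$\inf_{x\in\mathbb R}V''(x)\ \le\ \lambda_n(-L)-\lambda_{n-1}(-L)\ \le\ \sup_{x\in\mathbb R}V''(x),$$ with the right-hand side equal to $+\infty$ if $V''$ is unbounded from above.
   Context: $V\in C^\infty(\mathbb R)$, $\mu$ the probability measure with density proportional to $e^{-V}$, $Lf=f''-V'f'$, self-adjoint in $L^2(\mu)$ (unique extension from $C_0^\infty(\mathbb R)$). $\lambda_0(-L)=0$ and for $n\ge1$, $\lambda_n(-L)=\sup_{g_0,\dots,g_{n-1}\in L^2(\mu)}\inf_{f\in D(-L)\setminus\{0\},\,f\perp_\mu g_i}\frac{\int f(-Lf)\,d\mu}{\int f^2d\mu}$. *)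

(* Defs.v *)
From HB Require Import structures.
From mathcomp Require Import all_boot all_order all_algebra.
From mathcomp Require Import all_classical all_reals all_analysis.
Set Implicit Arguments. Unset Strict Implicit. Unset Printing Implicit Defensive.
Import Order.TTheory GRing.Theory Num.Theory.
Import numFieldNormedType.Exports.
Local Open Scope classical_set_scope.
Local Open Scope ring_scope.

Section Defs.
Variable R : realType.

Definition smooth (f : R -> R) : Prop :=
  forall (n : nat) (x : R), derivable (iter n (@derive1 R R) f) x 1.

Definition compact_supp (f : R -> R) : Prop :=
  exists M : R, forall x : R, M < `|x| -> f x = 0.

Definition Cc_inf (f : R -> R) : Prop := smooth f /\ compact_supp f.

Definition wgt (V : R -> R) (x : R) : R := expR (- V x).

Definition Zc (V : R -> R) : R :=
  fine (\int[@lebesgue_measure R]_x (wgt V x)%:E).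

Definition ipmu (V : R -> R) (f g : R -> R) : R :=
  fine (\int[@lebesgue_measure R]_x (f x * g x * wgt V x)%:E) / Zc V.

Definition L2mu (V : R -> R) (f : R -> R) : Prop :=
  measurable_fun setT f /\
  (\int[@lebesgue_measure R]_x ((f x ^+ 2) * wgt V x)%:E < +oo)%E.

Definition Lop (V : R -> R) (f : R -> R) : R -> R :=
  fun x => (derive1 (derive1 f)) x - derive1 V x * derive1 f x.

(* graph of the closure in L^2(mu) of L restricted to C_0^infinity, i.e. of
   the (unique) self-adjoint extension: (f, g) with f in D(L) and L f = g *)
Definition Lgraph (V : R -> R) (f g : R -> R) : Prop :=
  L2mu V f /\ L2mu V g /\
  exists u : nat -> R -> R,
    (forall k, Cc_inf (u k)) /\
    (fun k => ipmu V (u k \- f) (u k \- f)) @ \oo --> (0:R) /\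
    (fun k => ipmu V (Lop V (u k) \- g) (Lop V (u k) \- g)) @ \oo --> (0:R).

Definition rayleigh_set (V : R -> R) (n : nat) (gs : 'I_n -> R -> R)
  : set (\bar R) :=
  [set r | exists f Lf : R -> R,
     [/\ Lgraph V f Lf, 0 < ipmu V f f, (forall i, ipmu V f (gs i) = 0) &
         r = ((- ipmu V f Lf) / ipmu V f f)%:E]].

Definition lambda (V : R -> R) (n : nat) : \bar R :=
  match n with
  | 0 => 0%E
  | _ => ereal_sup [set ereal_inf (rayleigh_set V gs) | gs in
                      [set gs : 'I_n -> R -> R | forall i, L2mu V (gs i)]]
  end.

End Defs.

(* Main.v *)
Require Import Defs.
From HB Require Import structures.
From mathcomp Require Import all_boot all_order all_algebra.
From mathcomp Require Import all_classical all_reals all_analysis measurable_realfun.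
From mathcomp Require Import ring lra.
Set Implicit Arguments. Unset Strict Implicit. Unset Printing Implicit Defensive.
Import Order.TTheory GRing.Theory Num.Theory.
Import numFieldNormedType.Exports.
Local Open Scope classical_set_scope.
Local Open Scope ring_scope.

(** Write [A f = f'] and let [A* w = - w' + V' w] be its adjoint in L2(mu), so that
    [- L = A* A] while [A A* = - L + V'']. Hence - L restricted to the orthogonal of the
    constants is intertwined with - L + V'', and the n-th eigenvalue of - L should be
    the (n-1)-th eigenvalue of - L + V'', which lies between those of - L shifted by
    inf V'' and by sup V''. On the level of the max-min values, with w a test function:
    - if |w'|^2 >= b |w|^2 whenever w is orthogonal to h_1, ..., h_n,
      and f is orthogonal to 1 and to the primitives of the h_i, then f = A* w with w
      smooth, compactly supported and orthogonal to the h_i, and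
      |f|^2 = |w'|^2 + <V'' w, w>, |f|^2 = <f', w> <= |f'| |w|;
    - conversely one of n+1 constraints can be replaced by orthogonality to 1, and
      the other ones, for a primitive F of w, by constraints on w; then
      |w|^2 = <F, A* w> <= |F| |A* w|.
    The primitives must again be in L2(mu): this is why constraints are first moved to
    continuous compactly supported ones, at the cost of an arbitrarily small loss in the
    bound. That perturbation and the passage between the domain of L and test functions
    both rest on a bound that is stable for almost orthogonal functions. *)

(** * Smooth and compactly supported functions *)

Section SmoothFunctions.
Variable R : realType.
Implicit Types (f g : R -> R) (x a b c : R).

Lemma derive1_eq f df : (forall x, is_derive x (1 : R) f (df x)) -> derive1 f = df.
Proof. by move=> fdf; apply/funext => x; rewrite derive1E; have [_ ->] := fdf x. Qed.

Lemma is_derive_cst1 c x : is_derive x (1 : R) (fun=> c) 0.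
Proof. exact: is_derive_cst. Qed.

Lemma is_derive_add f g df dg x : is_derive x (1 : R) f df ->
  is_derive x (1 : R) g dg -> is_derive x (1 : R) (fun y => f y + g y) (df + dg).
Proof. by move=> hf hg; apply: is_deriveD. Qed.

Lemma is_derive_opp f df x : is_derive x (1 : R) f df ->
  is_derive x (1 : R) (fun y => - f y) (- df).
Proof. by move=> hf; apply: is_deriveN. Qed.

Lemma is_derive_mul f g df dg x : is_derive x (1 : R) f df ->
  is_derive x (1 : R) g dg ->
  is_derive x (1 : R) (fun y => f y * g y) (df * g x + f x * dg).
Proof.
move=> hf hg; have h := is_deriveM hf hg.
by apply: is_derive_eq h _; rewrite /GRing.scale /= addrC (mulrC (g x)).
Qed.

Lemma is_derive_affine f df a b x : is_derive (a * x + b) (1 : R) f df ->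
  is_derive x (1 : R) (fun y => f (a * y + b)) (a * df).
Proof.
move=> hf.
have h : is_derive x (1 : R) (fun y => a * y + b) a.
  have h1 := is_derive_mul (is_derive_cst1 a x) (is_derive_id x (1 : R)).
  have h2 := is_derive_add h1 (is_derive_cst1 b x).
  by apply: is_derive_eq h2 _; rewrite /=; ring.
have := @is_derive1_comp _ f (fun y => a * y + b) x df a hf h.
by move=> h1; apply: is_derive_eq h1 _; rewrite mulrC.
Qed.

Lemma is_derive_exp f df x : is_derive x (1 : R) f df ->
  is_derive x (1 : R) (fun y => expR (f y)) (df * expR (f x)).
Proof.
move=> hf; have h := @is_derive1_comp _ expR f x (expR (f x)) df (is_derive_expR _) hf.
by apply: is_derive_eq h _; rewrite mulrC.
Qed.

(** Peels off the innermost derivative first, so that the closure properties go by induction on the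
    order for all functions at once; the [iter] in [smooth] unfolds from the outside. *)
Fixpoint times_derivable (n : nat) f : Prop :=
  if n is m.+1 then (forall x, derivable f x 1) /\ times_derivable m (derive1 f)
  else True.

Lemma smoothP f : smooth f <-> forall n, times_derivable n f.
Proof.
split=> [sf n|h n].
  elim: n f sf => [//|n IH] f sf /=; split; first exact: (sf 0).
  by apply: IH => m x; rewrite -iterSr; exact: sf.
elim: n f h => [|n IH] f h x; first by have [] := h 1%N.
by rewrite iterSr; apply: IH => m; have [_] := h m.+1.
Qed.

Lemma smooth_derivable f x : smooth f -> derivable f x 1.
Proof. by move=> sf; exact: (sf 0). Qed.

Lemma smooth_derive1 f : smooth f -> smooth (derive1 f).
Proof. by move=> sf n x; rewrite -iterSr; exact: (sf n.+1). Qed.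

Lemma smooth_is_derive f x : smooth f -> is_derive x (1 : R) f (derive1 f x).
Proof.
by move=> sf; rewrite derive1E; apply: derivableP; exact: smooth_derivable.
Qed.

Lemma smooth_of_derive f df :
  (forall x, is_derive x (1 : R) f (df x)) -> smooth df -> smooth f.
Proof.
move=> fdf sdf [|n] x; first by have [] := fdf x.
by rewrite iterSr (derive1_eq fdf); exact: sdf.
Qed.

Lemma smooth_continuous f : smooth f -> continuous f.
Proof.
move=> sf x; apply: differentiable_continuous.
by apply/derivable1_diffP; exact: smooth_derivable.
Qed.

Lemma smooth_cst c : smooth (fun _ : R => c).
Proof.
move=> n; have -> : iter n (@derive1 R R) (fun=> c) = fun=> if n is 0 then c else 0.
  case: n => [//|n]; elim: n => [|n /= IH].
    exact: (derive1_eq (is_derive_cst1 _)).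
  by rewrite /= IH; exact: (derive1_eq (is_derive_cst1 _)).
by move=> x; exact: derivable_cst.
Qed.

Lemma times_derivableW n f : times_derivable n.+1 f -> times_derivable n f.
Proof.
by elim: n f => [//|n IH] f [df h]; split => //; exact: IH.
Qed.

Lemma times_derivableD n f g : times_derivable n f -> times_derivable n g ->
  times_derivable n (fun x => f x + g x).
Proof.
elim: n f g => [//|n IH] f g [df hf] [dg hg].
have h x : is_derive x (1 : R) (fun y => f y + g y) (derive1 f x + derive1 g x).
  by apply: is_derive_add; rewrite derive1E; exact: derivableP.
by split; [move=> x; have [] := h x|rewrite (derive1_eq h); exact: IH].
Qed.

Lemma times_derivableM n f g : times_derivable n f -> times_derivable n g ->
  times_derivable n (fun x => f x * g x).
Proof.
elim: n f g => [//|n IH] f g hf hg.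
(* Each term of the Leibniz rule keeps one factor undifferentiated, whose order has to be lowered to
   [n] before the induction hypothesis applies. *)
have hf' := times_derivableW hf; have hg' := times_derivableW hg.
case: hf hg => df hf [dg hg].
have h x : is_derive x (1 : R) (fun y => f y * g y) (derive1 f x * g x + f x * derive1 g x).
  by apply: is_derive_mul; rewrite derive1E; exact: derivableP.
split; first by move=> x; have [] := h x.
by rewrite (derive1_eq h); apply: times_derivableD; exact: IH.
Qed.

Lemma smoothD f g : smooth f -> smooth g -> smooth (fun x => f x + g x).
Proof.
by move=> /smoothP sf /smoothP sg; apply/smoothP => n; exact: times_derivableD.
Qed.

Lemma smoothM f g : smooth f -> smooth g -> smooth (fun x => f x * g x).
Proof.
by move=> /smoothP sf /smoothP sg; apply/smoothP => n; exact: times_derivableM.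
Qed.

Lemma smoothZ c f : smooth f -> smooth (fun x => c * f x).
Proof. by apply: smoothM; exact: smooth_cst. Qed.

Lemma smoothN f : smooth f -> smooth (fun x => - f x).
Proof.
move=> sf; rewrite (_ : (fun x => - f x) = (fun x => -1 * f x)).
  exact: smoothZ.
by apply/funext => x; rewrite mulN1r.
Qed.

(** The derivative is [f'] times the same exponential, so the induction on the order feeds on itself
    through the product rule. *)
Lemma smooth_exp f : smooth f -> smooth (fun x => expR (f x)).
Proof.
move=> sf; apply/smoothP => n; elim: n => [//|n IH].
have h x : is_derive x (1 : R) (fun y => expR (f y)) (derive1 f x * expR (f x)).
  exact/is_derive_exp/smooth_is_derive.
split; first by move=> x; have [] := h x.
rewrite (derive1_eq h); apply: times_derivableM => //.
exact: (proj1 (smoothP _) (smooth_derive1 sf)).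
Qed.

Lemma smooth_affine f a b : smooth f -> smooth (fun x => f (a * x + b)).
Proof.
move=> /smoothP sf; apply/smoothP => n.
elim: n f sf => [//|n IH] f sf.
have h x : is_derive x (1 : R) (fun y => f (a * y + b)) (a * derive1 f (a * x + b)).
  apply: is_derive_affine; rewrite derive1E; apply: derivableP.
  by have [] := sf 1%N.
split; first by move=> x; have [] := h x.
rewrite (derive1_eq h); apply: times_derivableM.
  exact: (proj1 (smoothP _) (@smooth_cst a)).

by apply: IH => m; have [_] := sf m.+1.
Qed.

Lemma smooth_sum n (f : 'I_n -> R -> R) : (forall i, smooth (f i)) ->
  smooth (fun x => \sum_(i < n) f i x).
Proof.
elim: n f => [|n IH] f sf.
  rewrite (_ : (fun x => _) = fun=> 0); first exact: smooth_cst.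
  by apply/funext => x; rewrite big_ord0.
rewrite (_ : (fun x => _) =
  fun x => (\sum_(i < n) f (widen_ord (leqnSn n) i) x) + f ord_max x).
  by apply: smoothD => //; exact: (IH (fun i => f (widen_ord (leqnSn n) i))).
by apply/funext => x; rewrite big_ord_recr.
Qed.

Lemma derive1_sum n (f : 'I_n -> R -> R) : (forall i, smooth (f i)) ->
  derive1 (fun x => \sum_(i < n) f i x) = fun x => \sum_(i < n) derive1 (f i) x.
Proof.
move=> sf; apply: derive1_eq => x.
elim: n f sf => [|n IH] f sf.
  rewrite big_ord0 (_ : (fun x => _) = fun=> 0); first exact: is_derive_cst1.
  by apply/funext => y; rewrite big_ord0.
rewrite big_ord_recr (_ : (fun x => _) =
  fun x => (\sum_(i < n) f (widen_ord (leqnSn n) i) x) + f ord_max x).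
  apply: is_derive_add; last exact: smooth_is_derive.
  exact: (IH (fun i => f (widen_ord (leqnSn n) i))).
by apply/funext => y; rewrite big_ord_recr.
Qed.

Lemma derive1D f g : smooth f -> smooth g ->
  derive1 (fun x => f x + g x) = fun x => derive1 f x + derive1 g x.
Proof.
by move=> sf sg; apply: derive1_eq => x; apply: is_derive_add; exact: smooth_is_derive.
Qed.

Lemma derive1M f g : smooth f -> smooth g ->
  derive1 (fun x => f x * g x) = fun x => derive1 f x * g x + f x * derive1 g x.
Proof.
by move=> sf sg; apply: derive1_eq => x; apply: is_derive_mul; exact: smooth_is_derive.
Qed.

Lemma derive1Z c f : smooth f -> derive1 (fun x => c * f x) = fun x => c * derive1 f x.
Proof.
move=> sf; rewrite (derive1M (@smooth_cst c) sf); apply/funext => x.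
by rewrite (derive1_eq (is_derive_cst1 c)) mul0r add0r.
Qed.

Lemma compact_suppM f g : compact_supp f -> compact_supp (fun x => f x * g x).
Proof. by move=> [M h]; exists M => x xM; rewrite h// mul0r. Qed.

Lemma compact_suppMr f g : compact_supp g -> compact_supp (fun x => f x * g x).
Proof. by move=> [M h]; exists M => x xM; rewrite h// mulr0. Qed.

Lemma compact_suppD f g : compact_supp f -> compact_supp g ->
  compact_supp (fun x => f x + g x).
Proof.
move=> [M h] [N k]; exists (Num.max M N) => x; rewrite gt_max => /andP[xM xN].
by rewrite h// k// addr0.
Qed.

Lemma compact_suppN f : compact_supp f -> compact_supp (fun x => - f x).
Proof. by move=> [M h]; exists M => x xM; rewrite h// oppr0. Qed.

Lemma compact_supp_sum n (f : 'I_n -> R -> R) : (forall i, compact_supp (f i)) ->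
  compact_supp (fun x => \sum_(i < n) f i x).
Proof.
elim: n f => [|n IH] f sf; first by exists 0 => x _; rewrite big_ord0.
rewrite (_ : (fun x => _) =
  fun x => (\sum_(i < n) f (widen_ord (leqnSn n) i) x) + f ord_max x).
  by apply: compact_suppD => //; exact: (IH (fun i => f (widen_ord (leqnSn n) i))).
by apply/funext => x; rewrite big_ord_recr.
Qed.

Lemma derive1_near0 f x : (\forall y \near x, f y = 0) -> derive1 f x = 0.
Proof.
move=> f0; rewrite derive1E.
have -> : 'D_1 f x = 'D_1 (fun=> 0 : R) x.
  by apply: near_eq_derive => //; rewrite ?oner_eq0.
exact: derive_cst.
Qed.

Lemma near_supp f M x : (forall y, M < `|y| -> f y = 0) -> M < `|x| ->
  \forall y \near x, f y = 0.
Proof.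
move=> h xM; have : \forall y \near x, M < `|y|.
  have : (fun y => `|y|) @ x --> `|x| by exact: norm_continuous.
  by move/cvgr_gt; apply.
by apply: filterS => y; exact: h.
Qed.

Lemma compact_supp_derive1 f : compact_supp f -> compact_supp (derive1 f).
Proof.
by move=> [M h]; exists M => x xM; apply: derive1_near0; exact: near_supp xM.
Qed.

Lemma Cc_infD f g : Cc_inf f -> Cc_inf g -> Cc_inf (fun x => f x + g x).
Proof. by move=> [? ?] [? ?]; split; [exact: smoothD|exact: compact_suppD]. Qed.

Lemma Cc_infM f g : smooth f -> Cc_inf g -> Cc_inf (fun x => f x * g x).
Proof. by move=> ? [? ?]; split; [exact: smoothM|exact: compact_suppMr]. Qed.

Lemma Cc_infZ c f : Cc_inf f -> Cc_inf (fun x => c * f x).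
Proof. by apply: Cc_infM; exact: smooth_cst. Qed.

Lemma Cc_inf_derive1 f : Cc_inf f -> Cc_inf (derive1 f).
Proof.
by move=> [? ?]; split; [exact: smooth_derive1|exact: compact_supp_derive1].
Qed.

Lemma Cc_inf_sum n (f : 'I_n -> R -> R) : (forall i, Cc_inf (f i)) ->
  Cc_inf (fun x => \sum_(i < n) f i x).
Proof.
by move=> h; split; [apply: smooth_sum => i|apply: compact_supp_sum => i];
  have [] := h i.
Qed.

End SmoothFunctions.

(** * Primitives and integrals of compactly supported functions *)

Section CompactlySupportedIntegrals.
Variable R : realType.
Implicit Types (f g u : R -> R) (x M : R).
Notation leb := (@lebesgue_measure R).

(** With a positive radius and a large inequality, the vanishing also holds at the ends of
    [[-M, M]], where boundary terms are evaluated. *)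
Lemma compact_suppP f : compact_supp f ->
  exists2 M : R, 0 < M & forall x, M <= `|x| -> f x = 0.
Proof.
move=> [M h]; exists (`|M| + 1); first by rewrite ltr_wpDl.
by move=> x Mx; apply: h; rewrite (lt_le_trans _ Mx)// (le_lt_trans (ler_norm M))// ltrDl.
Qed.

Lemma compact_supp_patch f M : (forall x, M <= `|x| -> f x = 0) ->
  f = f \_ `[- M, M].
Proof.
move=> fM; apply/funext => x; rewrite patchE; case: ifPn => //.
rewrite notin_setE/= in_itv/= => /negP; rewrite -ler_norml -ltNge => /ltW.
exact: fM.
Qed.

Lemma integrable_patch_itv (i : interval R) f :
  leb.-integrable [set` i] (EFin \o f) ->
  leb.-integrable setT (EFin \o (f \_ [set` i])).
Proof.
move=> fi; rewrite -restrict_EFin.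
by have := @integrable_mkcond _ _ R leb [set` i] (EFin \o f) (measurable_itv _);
  move=> -[h _]; exact: h.
Qed.

Lemma Cc_integrable f : continuous f -> compact_supp f ->
  leb.-integrable setT (EFin \o f).
Proof.
move=> cf /compact_suppP[M M0 fM]; rewrite (compact_supp_patch fM).
apply: integrable_patch_itv.
apply: continuous_compact_integrable; first exact: segment_compact.
exact: continuous_subspaceT.
Qed.

Lemma Rintegral_compact_supp f M : (forall x, M <= `|x| -> f x = 0) ->
  \int[leb]_x f x = \int[leb]_(x in `[- M, M]) f x.
Proof.
move=> fM; have -> := @Rintegral_mkcond _ _ R leb `[-M,M] f. by rewrite -compact_supp_patch.
Qed.

Lemma Rintegral_derive_eq0 f df : (forall x, is_derive x (1 : R) f (df x)) ->
  continuous df -> compact_supp f -> \int[leb]_x df x = 0.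
Proof.
move=> fdf cdf cf; have cdf' : compact_supp df.
  by rewrite -(derive1_eq fdf); exact: compact_supp_derive1.
have [M M0 fM] := compact_suppP cf.
have [N N0 fN] := compact_suppP cdf'.
(* Beyond [K] both [f] and [df] vanish: the integral lives on [[-K, K]] and its boundary terms are
   zero. *)
pose K := Num.max M N.
have fK x : K <= `|x| -> f x = 0 by rewrite ge_max => /andP[? _]; exact: fM.
have dfK x : K <= `|x| -> df x = 0 by rewrite ge_max => /andP[_ ?]; exact: fN.
have K0 : 0 < K by rewrite lt_max M0.
have cntf : continuous f.
  move=> x; apply: differentiable_continuous; apply/derivable1_diffP.
  by have [] := fdf x.
rewrite (Rintegral_compact_supp dfK) /Rintegral.
rewrite (@continuous_FTC2 _ df f).
- by rewrite !fK ?subee//= ?normrN ger0_norm ?lexx// ltW.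
- by rewrite gtrN.
- exact: continuous_subspaceT.
- split; first by move=> x _; have [] := fdf x.
  + by apply: cvg_at_right_filter; exact: cntf.
  + by apply: cvg_at_left_filter; exact: cntf.
- by move=> x _; rewrite (derive1_eq fdf).
Qed.

(** Based at minus infinity, so that it vanishes to the left of the support of [u], and also to the
    right of it when [u] has integral zero. *)
Definition primitive u x : R := \int[leb]_(t in `]-oo, x]) u t.

Lemma is_derive_primitive u x : continuous u -> compact_supp u ->
  is_derive x (1 : R) (primitive u) (u x).
Proof.
move=> cu su.
have [dp <-] : derivable (primitive u) x 1 /\ derive1 (primitive u) x = u x.
  apply: (@continuous_FTC1 R u -oo%O x (x + 1)).
  - by rewrite ltrDl.
  - by apply: integrableS (Cc_integrable cu su).
  - by rewrite ltNyr.
  - exact: cu.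
by rewrite derive1E; exact: derivableP.
Qed.

Lemma primitive_left u M x : (forall x, M <= `|x| -> u x = 0) -> x <= - M ->
  primitive u x = 0.
Proof.
move=> uM xM; rewrite /primitive.
rewrite (@eq_Rintegral _ _ _ _ _ (fun=> 0)) ?Rintegral_cst ?mul0r//.
move=> t; rewrite inE/= in_itv/= => tx; apply: uM.
have tM := le_trans tx xM.
by rewrite ler_normr; apply/orP; right; rewrite lerNr.
Qed.

Lemma primitive_right u M x : (forall x, M <= `|x| -> u x = 0) -> M <= x ->
  primitive u x = \int[leb]_x u x.
Proof.
move=> uM Mx; rewrite /primitive; have -> := @Rintegral_mkcond _ _ R leb `]-oo, x] u.
apply: eq_Rintegral => t _; rewrite patchE; case: ifPn => //.
rewrite notin_setE/= in_itv/= => /negP; rewrite -ltNge => xt.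
by rewrite uM// (le_trans Mx)// (le_trans (ltW xt))// ler_norm.
Qed.

Lemma compact_supp_primitive u : compact_supp u -> \int[leb]_x u x = 0 ->
  compact_supp (primitive u).
Proof.
move=> /compact_suppP[M M0 uM] u0; exists M => x Mx.
have [x0|x0] := leP 0 x.
  by rewrite (primitive_right uM)// ltW//; rewrite ger0_norm in Mx.
by rewrite (primitive_left uM)// lerNr ltW//; rewrite ltr0_norm in Mx.
Qed.

Lemma primitive_bounded u : continuous u -> compact_supp u ->
  exists C, forall x, `|primitive u x| <= C.
Proof.
move=> cu su; exists (\int[leb]_x `|u x|) => x.
have iu := Cc_integrable cu su.
rewrite /primitive (le_trans (le_normr_Rintegral _ _))//.
  by apply: integrableS iu.
have -> := @Rintegral_mkcond _ _ R leb `]-oo, x] (fun t => `|u t|).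
apply: le_Rintegral => //.
- by apply: integrable_patch_itv; apply: integrable_norm; apply: integrableS iu.
- exact: integrable_norm.
- by move=> t _; rewrite patchE; case: ifP => _; rewrite ?lexx ?normr_ge0.
Qed.

Lemma smooth_primitive u : smooth u -> compact_supp u -> smooth (primitive u).
Proof.
move=> su cu; apply: (@smooth_of_derive R _ u) => // x.
by apply: is_derive_primitive => //; exact: smooth_continuous.
Qed.

End CompactlySupportedIntegrals.

(** * Smooth bumps and cutoffs *)

Section Cutoffs.
Variable R : realType.
Implicit Types (p : {poly R}) (f : R -> R) (x : R).
Notation leb := (@lebesgue_measure R).

(** The difference quotient at [x] is at most [C |h|]. This handles the origin, where flat functions
    are glued to zero. *)
Lemma is_derive_quadratic_bound f x C : f x = 0 ->
  (forall h, `|f (x + h)| <= C * h ^+ 2) -> is_derive x (1 : R) f 0.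
Proof.
move=> fx0 fC.
have C0 : 0 <= C.
  by have := fC 1; rewrite expr1n mulr1; apply: le_trans.
have cv : (fun h => h^-1 *: ((f \o shift x) (h *: (1 : R)) - f x)) @ 0^' --> (0 : R).
  apply/cvgr0Pnorm_le => e e0.
  have dlt : 0 < e / (C + 1) by rewrite divr_gt0// ltr_wpDl.
  exists (e / (C + 1)) => //= h; rewrite /ball/= sub0r normrN => hd h0.
  rewrite fx0 subr0 /= /GRing.scale /= mulr1 addrC normrM normfV.
  have h0' : 0 < `|h| by rewrite normr_gt0.
  rewrite ler_pdivrMl// (le_trans (fC h))// -real_normK ?num_real// expr2 mulrA.
  rewrite [leRHS]mulrC ler_pM2r//.
  have := ltW hd; rewrite ler_pdivlMr ?ltr_wpDl//; apply: le_trans.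
  by rewrite mulrDr mulr1 mulrC lerDl.
apply: DeriveDef; first by apply/cvg_ex; exists 0.
exact: cvg_lim cv.
Qed.

Lemma exprn_le_expR n x : 0 <= x -> x ^+ n <= n`!%:R * expR x.
Proof.
move=> x0; case: n => [|n].
  by rewrite expr0 fact0 mul1r (le_trans _ (expR_ge1Dx x))// lerDl.
rewrite -ler_pdivrMl ?ltr0n ?fact_gt0// mulrC.
by rewrite (le_trans _ (expR_ge1Dxn n x0))// lerDr.
Qed.

Lemma horner_le_expR p : exists C, forall x, 0 <= x -> `|p.[x]| <= C * expR x.
Proof.
exists (\sum_(i < size p) `|p`_i| * i`!%:R) => x x0.
rewrite horner_coef (le_trans (ler_norm_sum _ _ _))// mulr_suml.
apply: ler_sum => i _; rewrite normrM -mulrA ler_wpM2l// ger0_norm ?exprn_ge0//.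
exact: exprn_le_expR.
Qed.

(** The polynomial factor makes this class stable under differentiation, which reduces smoothness to
    an induction; [p = 1] is the classical flat function. *)
Definition flat p x : R := if 0 < x then p.[x^-1] * expR (- x^-1) else 0.

Lemma flat_pos p x : 0 < x -> flat p x = p.[x^-1] * expR (- x^-1).
Proof. by rewrite /flat => ->. Qed.

Lemma flat_neg p x : x <= 0 -> flat p x = 0.
Proof. by rewrite /flat leNgt => /negbTE ->. Qed.

Lemma is_derive_flat p x :
  is_derive x (1 : R) (flat p) (flat ('X^2 * (p - deriv p)) x).
Proof.
have [x0|x0|->] := ltgtP x 0.
- rewrite flat_neg ?ltW//.
  apply: (@near_eq_is_derive _ _ _ (fun=> 0)).
  by near=> y; rewrite flat_neg// ltW//; near: y; exact: lt_nbhsl.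
- rewrite flat_pos//.
  have near_pos : \forall y \near x, p.[y^-1] * expR (- y^-1) = flat p y.
    have : \forall y \near x, 0 < y by have /cvgr_gt := @cvg_id _ (nbhs x); apply.
    by apply: filterS => y y0; rewrite flat_pos.
  apply: (near_eq_is_derive near_pos).
  have hV : is_derive x (1 : R) (fun y : R => y^-1) (- x ^- 2).
    apply: DeriveDef; first by apply: derivableV; [rewrite gt_eqF|exact: derivable_id].
    by rewrite deriveV ?gt_eqF// derive_id /GRing.scale/= mulr1.
  have hp : is_derive x (1 : R) (fun y => p.[y^-1]) ((deriv p).[x^-1] * (- x ^- 2)).
    exact: (@is_derive1_comp _ (horner p) (fun y => y^-1)).
  have h := is_derive_mul hp (is_derive_exp (is_derive_opp hV)).
  by apply: is_derive_eq h _; rewrite hornerM hornerXn hornerD hornerN opprK -exprVn; ring.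
- rewrite flat_neg//.
  (* At [y = 1/h] the bound [|p(y)| y^2 <= C e^y] reads [|flat p h| <= C h^2]. *)
  have [C hC] := horner_le_expR (p * 'X^2).
  apply: (@is_derive_quadratic_bound _ _ C); first exact: flat_neg.
  move=> h; rewrite add0r; have [h0|h0] := leP h 0.
    rewrite flat_neg// normr0 mulr_ge0 ?sqr_ge0//.
    by have := hC 0 (lexx 0); rewrite expR0 mulr1; apply: le_trans.
  rewrite flat_pos// normrM (ger0_norm (expR_ge0 _)).
  have hh : 0 <= h^-1 by rewrite invr_ge0 ltW.
  have := hC _ hh; rewrite hornerM hornerXn normrM (ger0_norm (exprn_ge0 _ hh)).
  rewrite exprVn ler_pdivrMr ?exprn_gt0// => H.
  by rewrite expRN ler_pdivrMr ?expR_gt0// mulrAC.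
Unshelve. all: by end_near. Qed.

Lemma smooth_flat p : smooth (flat p).
Proof.
apply/smoothP => n; elim: n p => [//|n IH] p; split.
  by move=> x; have [] := is_derive_flat p x.
by rewrite (derive1_eq (is_derive_flat p)).
Qed.

(** Equal to [exp(- 1/x - 1/(1-x))] on the open unit interval and zero elsewhere; the argument
    [1 - x] is written in the shape of [smooth_affine]. *)
Definition bump_fun x : R := flat 1 x * flat 1 (-1 * x + 1).

Lemma smooth_bump_fun : smooth bump_fun.
Proof. by apply: smoothM; [|apply: smooth_affine]; exact: smooth_flat. Qed.

Lemma bump_fun_ge0 x : 0 <= bump_fun x.
Proof.
rewrite /bump_fun /flat mulr_ge0//; case: ifP => // _; rewrite hornerE mul1r expR_ge0//.
Qed.

Lemma bump_fun_gt0 x : 0 < x -> x < 1 -> 0 < bump_fun x.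
Proof.
move=> x0 x1; rewrite /bump_fun !flat_pos ?hornerE ?mul1r ?mulr_gt0 ?expR_gt0//.
by rewrite mulN1r addrC subr_gt0.
Qed.

Lemma bump_fun_left x : x <= 0 -> bump_fun x = 0.
Proof. by move=> x0; rewrite /bump_fun flat_neg ?mul0r. Qed.

Lemma bump_fun_right x : 1 <= x -> bump_fun x = 0.
Proof. by move=> x1; rewrite /bump_fun [X in _ * X]flat_neg ?mulr0// mulN1r addrC subr_le0. Qed.

Lemma bump_fun_supp x : 1 <= `|x| -> bump_fun x = 0.
Proof.
by rewrite ler_normr => /orP[/bump_fun_right//|x1]; apply: bump_fun_left; lra.
Qed.

Lemma Cc_inf_bump_fun : Cc_inf bump_fun.
Proof. by split; [exact: smooth_bump_fun|exists 1 => x /ltW; exact: bump_fun_supp]. Qed.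

(* If the integral of a nonnegative [f] vanished, its primitive would be
   nondecreasing and vanish on both sides, hence be constant. *)
Lemma Rintegral_gt0 f x : continuous f -> compact_supp f ->
  (forall y, 0 <= f y) -> 0 < f x -> 0 < \int[leb]_y f y.
Proof.
move=> cf sf f0 fx; rewrite lt_neqAle Rintegral_ge0// andbT.
apply/eqP => /esym If0.
have dP y := is_derive_primitive y cf sf.
have [M M0 fM] := compact_suppP sf.
have [N hN] := compact_supp_primitive sf If0.
have mono a b : a <= b -> primitive f a <= primitive f b.
  move=> ab; apply: (@ger0_derive1_ndecr _ _ a b) => //.
  - by move=> y _; rewrite (derive1_eq dP).
  - apply: continuous_subspaceT => y; apply: differentiable_continuous.
    by apply/derivable1_diffP; have [] := dP y.
have P0 y : primitive f y = 0.
  pose K := `|y| + `|N| + 1.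
  have yK : - K <= y <= K.
    by rewrite -ler_norml /K -addrA lerDl addr_ge0.
  have NK : N < `|K|.
    rewrite ger0_norm ?addr_ge0// /K -addrA addrCA (le_lt_trans (ler_norm N))//.
    by rewrite ltrDl ltr_wpDl.
  case/andP: yK => /mono; rewrite (hN (- K)) ?normrN// => y1 /mono; rewrite (hN K)// => y2.
  by apply/eqP; rewrite eq_le y1 y2.
have : f x = 0.
  have h : \forall y \near x, primitive f y = 0 by apply: filterE.
  by have := derive1_near0 h; rewrite (derive1_eq dP).
by move=> fx0; rewrite fx0 ltxx in fx.
Qed.

Definition smooth_step x : R := (\int[leb]_y bump_fun y)^-1 * primitive bump_fun x.

Lemma smooth_cutoffs : exists (chi : nat -> R -> R) (C : R),
  [/\ forall k, Cc_inf (chi k), forall k x, `|chi k x| <= C,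
      forall k x, `|derive1 (chi k) x| <= C &
      forall (k : nat) x, `|x| < k%:R -> chi k x = 1].
Proof.
have cb : continuous bump_fun by apply: smooth_continuous; exact: smooth_bump_fun.
have [_ sb] := Cc_inf_bump_fun.
have c0 : 0 < \int[leb]_y bump_fun y.
  apply: (@Rintegral_gt0 _ (2^-1)) => //; first exact: bump_fun_ge0.
  by apply: bump_fun_gt0; lra.
have ss : smooth smooth_step.
  by apply: smoothZ; apply: smooth_primitive => //; exact: smooth_bump_fun.
have step0 x : x <= -1 -> smooth_step x = 0.
  by move=> x1; rewrite /smooth_step (primitive_left bump_fun_supp)// mulr0.
have step1 x : 1 <= x -> smooth_step x = 1.
  by move=> x1; rewrite /smooth_step (primitive_right bump_fun_supp)// mulVf ?gt_eqF.
have [B hB] := primitive_bounded cb sb.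
have B0 : 0 <= B by apply: le_trans (hB 0).
have dss : derive1 smooth_step = fun x => (\int[leb]_y bump_fun y)^-1 * bump_fun x.
  apply: derive1_eq => x.
  have h := is_derive_mul (is_derive_cst1 (\int[leb]_y bump_fun y)^-1 x)
    (is_derive_primitive x cb sb).
  by apply: is_derive_eq h _; rewrite mul0r add0r.
have bump1 x : bump_fun x <= 1.
  rewrite /bump_fun /flat; case: ifP => [x0|_]; last by rewrite mul0r ler01.
  case: ifP => [x1|_]; last by rewrite mulr0 ler01.
  have le1 y : 0 < y -> 0 <= (1 : {poly R}).[y^-1] * expR (- y^-1) <= 1.
    by move=> y0; rewrite hornerC mul1r expR_ge0 expR_le1 oppr_le0 invr_ge0 ltW.
  by case/andP: (le1 _ x0) => ? ?; case/andP: (le1 _ x1) => ? ?; exact: mulr_ile1.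
(* One constant for two bounds: [B] controls the primitive of the bump, and 1 controls the bump
   itself. *)
pose A := (\int[leb]_y bump_fun y)^-1 * (B + 1).
have A0 : 0 <= A by rewrite mulr_ge0 ?invr_ge0 ?ltW// ltr_wpDl.
have ci0 : 0 <= (\int[leb]_y bump_fun y)^-1 by rewrite invr_ge0 ltW.
have ssA x : `|smooth_step x| <= A.
  rewrite /A /smooth_step normrM (ger0_norm ci0) ler_wpM2l//.
  by rewrite (le_trans (hB x))// lerDl.
have dssA x : `|derive1 smooth_step x| <= A.
  rewrite dss /A normrM (ger0_norm ci0) ler_wpM2l//.
  by rewrite ger0_norm ?bump_fun_ge0// (le_trans (bump1 x))// lerDr.
have [D [sD DA]] : exists D : R -> R,
    (forall x, is_derive x (1 : R) smooth_step (D x)) /\ forall x, `|D x| <= A.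
  by exists (derive1 smooth_step); split => // x; exact: smooth_is_derive.
(* From here on the step is any smooth function with these limits and bounds. *)
move: smooth_step ss step0 step1 {dss} ssA {dssA} sD => st ss step0 step1 ssA sD.
move: A A0 ssA DA => A A0 ssA DA.
(* The shift by [k + 1] puts both arguments above 1 when [|x| < k], and one of them below -1 when
   [|x| > k + 2]. *)
pose l (k : nat) (x : R) := st (1 * x + k.+1%:R).
pose r (k : nat) (x : R) := st (-1 * x + k.+1%:R).
have sl k : smooth (l k) by exact: smooth_affine.
have sr k : smooth (r k) by exact: smooth_affine.
exists (fun k x => l k x * r k x), (A * A + A * A); split.
- move=> k; split; first exact: (smoothM (sl k) (sr k)).
  exists (k.+2)%:R => x; rewrite ltr_normr -!natr1 => /orP[xk|xk].
    by rewrite /r step0 ?mulr0//; rewrite -natr1; lra.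
  by rewrite /l step0 ?mul0r//; rewrite -natr1; lra.
- move=> k x; rewrite normrM (@le_trans _ _ (A * A))//.
    exact: (ler_pM (normr_ge0 _) (normr_ge0 _) (ssA _) (ssA _)).
  by rewrite lerDl mulr_ge0.
- move=> k x; rewrite (derive1M (sl k) (sr k)) (le_trans (ler_normD _ _))//.
  have dl : derive1 (l k) = fun x => 1 * D (1 * x + k.+1%:R).
    by apply: derive1_eq => y; exact: is_derive_affine.
  have dr : derive1 (r k) = fun x => -1 * D (-1 * x + k.+1%:R).
    by apply: derive1_eq => y; exact: is_derive_affine.
  have dlA : `|derive1 (l k) x| <= A by rewrite dl mul1r.
  have drA : `|derive1 (r k) x| <= A by rewrite dr mulN1r normrN.
  by rewrite !normrM; apply: lerD; apply: ler_pM; rewrite ?normr_ge0// ssA.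
- move=> k x; rewrite ltr_norml => /andP[xk1 xk2].
  by rewrite /l /r !step1 ?mulr1//; rewrite -natr1; lra.
Qed.

End Cutoffs.

(** * The weighted space L2(mu) *)

Section WeightedL2.
Variables (R : realType) (V : R -> R).
Hypothesis cV : continuous V.
Hypothesis hZ : (\int[@lebesgue_measure R]_x (wgt V x)%:E < +oo)%E.
Implicit Types (f g h u : R -> R) (x c : R).
Notation leb := (@lebesgue_measure R).

Definition mean u : R := fine (\int[leb]_x (u x * wgt V x)%:E) / Zc V.

Definition mu_integrable u : Prop :=
  leb.-integrable setT (EFin \o (fun x => u x * wgt V x)).

Lemma ipmuE f g : ipmu V f g = mean (fun x => f x * g x).
Proof. by []. Qed.

Lemma wgt_gt0 x : 0 < wgt V x.
Proof. exact: expR_gt0. Qed.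

Lemma wgt_ge0 x : 0 <= wgt V x.
Proof. exact: expR_ge0. Qed.

Lemma continuous_wgt : continuous (wgt V).
Proof.
move=> x; rewrite /wgt.
apply: (@continuous_comp _ _ _ (fun x => - V x) expR); last exact: continuous_expR.
by apply: continuousN; exact: cV.
Qed.

Lemma measurable_wgt : measurable_fun setT (wgt V).
Proof. by apply: continuous_measurable_fun; exact: continuous_wgt. Qed.

Lemma Zc_ge0 : 0 <= Zc V.
Proof. by apply: Rintegral_ge0 => x _; exact: wgt_ge0. Qed.

Lemma mu_integrable1 : mu_integrable (fun=> 1).
Proof.
apply/integrableP; split.
  apply/measurable_EFinP; rewrite (_ : (fun _ => _) = wgt V); first exact: measurable_wgt.
  by apply/funext => x; rewrite mul1r.
under eq_integral do rewrite /= mul1r ger0_norm ?wgt_ge0//.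
exact: hZ.
Qed.

Lemma mu_integrable_le f g : measurable_fun setT f ->
  (forall x, `|f x| <= g x) -> mu_integrable g -> mu_integrable f.
Proof.
move=> mf fg ig; apply: le_integrable ig => //.
  by apply/measurable_EFinP; apply: measurable_funM => //; exact: measurable_wgt.
move=> x _; rewrite /= lee_fin !normrM ler_wpM2r//.
by rewrite (le_trans (fg x))// ler_norm.
Qed.

Lemma mu_integrableD f g : mu_integrable f -> mu_integrable g ->
  mu_integrable (fun x => f x + g x).
Proof.
move=> If Ig; have := @integrableD _ _ R leb setT _ _ _ If Ig.
move=> /(_ measurableT); apply: eq_integrable => // x _.
by rewrite /= mulrDl EFinD.
Qed.

Lemma mu_integrableZ c f : mu_integrable f -> mu_integrable (fun x => c * f x).
Proof.
move=> If; have := @integrableZl _ _ R leb setT _ c _ If.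
move=> /(_ measurableT); apply: eq_integrable => // x _.
by rewrite /= -EFinM mulrA.
Qed.

Lemma meanD f g : mu_integrable f -> mu_integrable g ->
  mean (fun x => f x + g x) = mean f + mean g.
Proof.
move=> If Ig; rewrite /mean -mulrDl; congr (_ / _).
rewrite -(@RintegralD _ _ R leb)//; apply: eq_Rintegral => x _.
by rewrite mulrDl.
Qed.

Lemma meanZ c f : mu_integrable f -> mean (fun x => c * f x) = c * mean f.
Proof.
move=> If; rewrite /mean mulrA; congr (_ / _).
rewrite -(@RintegralZl _ _ R leb)//; apply: eq_Rintegral => x _.
by rewrite mulrA.
Qed.

Lemma mean_ge0 f : (forall x, 0 <= f x) -> 0 <= mean f.
Proof.
move=> f0; rewrite divr_ge0 ?Zc_ge0//; apply: Rintegral_ge0 => x _.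
by rewrite mulr_ge0 ?wgt_ge0.
Qed.

Lemma mean_eq f g : f =1 g -> mean f = mean g.
Proof. by move=> /funext ->. Qed.

Lemma le_mean f g : mu_integrable f -> mu_integrable g ->
  (forall x, f x <= g x) -> mean f <= mean g.
Proof.
move=> If Ig fg; rewrite ler_wpM2r ?invr_ge0 ?Zc_ge0//.
by apply: le_Rintegral => // x _; rewrite ler_wpM2r ?wgt_ge0.
Qed.

Lemma L2muP f : L2mu V f <->
  measurable_fun setT f /\ mu_integrable (fun x => f x ^+ 2).
Proof.
have E : (\int[leb]_x `|(f x ^+ 2 * wgt V x)%:E| =
          \int[leb]_x (f x ^+ 2 * wgt V x)%:E)%E.
  apply: eq_integral => x _; rewrite gee0_abs// lee_fin.
  by rewrite mulr_ge0 ?sqr_ge0 ?wgt_ge0.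
split=> [[mf fi]|[mf /integrableP[_ fi]]]; split => //.
  apply/integrableP; split; last by rewrite [X in (X < _)%E]E.
  apply/measurable_EFinP; apply: measurable_funM; last exact: measurable_wgt.
  exact: measurable_funX.
by rewrite [X in (X < _)%E]E in fi.
Qed.

Lemma L2mu_measurable f : L2mu V f -> measurable_fun setT f.
Proof. by case. Qed.

(** Domination by [f^2 + g^2]. *)
Lemma L2muM_integrable f g : L2mu V f -> L2mu V g ->
  mu_integrable (fun x => f x * g x).
Proof.
move=> /L2muP[mf If] /L2muP[mg Ig].
apply: mu_integrable_le (mu_integrableD If Ig); first exact: measurable_funM.
move=> x; rewrite ler_norml; apply/andP; split.
  by have := sqr_ge0 (f x + g x); nra.
by have := sqr_ge0 (f x - g x); nra.
Qed.

Lemma L2muD f g : L2mu V f -> L2mu V g -> L2mu V (fun x => f x + g x).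
Proof.
move=> hf hg; have [mf If] := (L2muP _).1 hf; have [mg Ig] := (L2muP _).1 hg.
apply/L2muP; split; first exact: measurable_funD.
have := mu_integrableD (mu_integrableD If Ig) (mu_integrableZ 2 (L2muM_integrable hf hg)).
by congr mu_integrable; apply/funext => x; ring.
Qed.

Lemma L2muZ c f : L2mu V f -> L2mu V (fun x => c * f x).
Proof.
move=> /L2muP[mf If]; apply/L2muP; split.
  by apply: measurable_funM => //; exact: measurable_cst.
have := mu_integrableZ (c ^+ 2) If.
by congr mu_integrable; apply/funext => x; rewrite exprMn.
Qed.

Lemma L2muB f g : L2mu V f -> L2mu V g -> L2mu V (fun x => f x - g x).
Proof.
move=> hf hg; rewrite (_ : (fun x => _) = fun x => f x + -1 * g x).
  by apply: L2muD => //; exact: L2muZ.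
by apply/funext => x; rewrite mulN1r.
Qed.

Lemma L2mu_bounded f c : measurable_fun setT f -> (forall x, `|f x| <= c) ->
  L2mu V f.
Proof.
move=> mf fc; apply/L2muP; split => //.
have c0 : 0 <= c by apply: le_trans (fc 0).
apply: mu_integrable_le (mu_integrableZ (c ^+ 2) mu_integrable1).
  exact: measurable_funX.
by move=> x; rewrite mulr1 normrX lerXn2r// nnegrE.
Qed.

Lemma L2mu_cst c : L2mu V (fun=> c).
Proof. by apply: (@L2mu_bounded _ `|c|) => //; exact: measurable_cst. Qed.

Lemma continuous_compact_supp_bounded f : continuous f -> compact_supp f ->
  exists c, forall x, `|f x| <= c.
Proof.
move=> cf /compact_suppP[M M0 fM].
have [c [_ hc]] := compact_bounded (continuous_compact
  (@continuous_subspaceT _ _ `[- M, M] f cf) (@segment_compact _ (- M) M)).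
exists (Num.max 0 (c + 1)) => x; rewrite le_max.
have [Mx|xM] := leP M `|x|; first by rewrite fM// normr0 lexx.
apply/orP; right; apply: (hc (c + 1)); first by rewrite ltrDl.
by exists x => //; rewrite /= in_itv/= -ler_norml ltW.
Qed.

Lemma L2mu_Cc f : continuous f -> compact_supp f -> L2mu V f.
Proof.
move=> cf sf; have [c fc] := continuous_compact_supp_bounded cf sf.
by apply: (L2mu_bounded _ fc); exact: continuous_measurable_fun.
Qed.

Lemma L2mu_Cc_inf f : Cc_inf f -> L2mu V f.
Proof. by move=> [sf ?]; apply: L2mu_Cc => //; exact: smooth_continuous. Qed.

Lemma L2mu_sum n (f : 'I_n -> R -> R) : (forall i, L2mu V (f i)) ->
  L2mu V (fun x => \sum_(i < n) f i x).
Proof.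
elim: n f => [|n IH] f hf.
  rewrite (_ : (fun x => _) = fun=> 0); first exact: L2mu_cst.
  by apply/funext => x; rewrite big_ord0.
rewrite (_ : (fun x => _) =
  fun x => (\sum_(i < n) f (widen_ord (leqnSn n) i) x) + f ord_max x).
  by apply: L2muD => //; exact: (IH (fun i => f (widen_ord (leqnSn n) i))).
by apply/funext => x; rewrite big_ord_recr.
Qed.

Lemma ipmuC f g : ipmu V f g = ipmu V g f.
Proof. by rewrite !ipmuE; apply: mean_eq => x; rewrite mulrC. Qed.

Lemma ipmuDl f g h : L2mu V f -> L2mu V g -> L2mu V h ->
  ipmu V (fun x => f x + g x) h = ipmu V f h + ipmu V g h.
Proof.
move=> hf hg hh; rewrite !ipmuE -meanD; try exact: L2muM_integrable.
by apply: mean_eq => x; rewrite mulrDl.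
Qed.

Lemma ipmuZl c f h : L2mu V f -> L2mu V h ->
  ipmu V (fun x => c * f x) h = c * ipmu V f h.
Proof.
move=> hf hh; rewrite !ipmuE -meanZ; last exact: L2muM_integrable.
by apply: mean_eq => x; rewrite mulrA.
Qed.

Lemma ipmuBl f g h : L2mu V f -> L2mu V g -> L2mu V h ->
  ipmu V (fun x => f x - g x) h = ipmu V f h - ipmu V g h.
Proof.
move=> hf hg hh; rewrite (_ : (fun x => _) = fun x => f x + -1 * g x).
  by rewrite ipmuDl ?ipmuZl ?mulN1r//; exact: L2muZ.
by apply/funext => x; rewrite mulN1r.
Qed.

Lemma ipmu0l h : ipmu V (fun=> 0) h = 0.
Proof.
rewrite ipmuE /mean (_ : fine _ = 0) ?mul0r//.
by under eq_integral do rewrite !mul0r; rewrite integral0.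
Qed.

Lemma ipmu_suml n (f : 'I_n -> R -> R) h : (forall i, L2mu V (f i)) -> L2mu V h ->
  ipmu V (fun x => \sum_(i < n) f i x) h = \sum_(i < n) ipmu V (f i) h.
Proof.
elim: n f => [|n IH] f hf hh.
  rewrite big_ord0 (_ : (fun x => _) = fun=> 0) ?ipmu0l//.
  by apply/funext => x; rewrite big_ord0.
rewrite big_ord_recr/= (_ : (fun x => _) =
  fun x => (\sum_(i < n) f (widen_ord (leqnSn n) i) x) + f ord_max x).
  rewrite ipmuDl//; last exact: (L2mu_sum (fun i => hf (widen_ord (leqnSn n) i))).
  by rewrite (IH (fun i => f (widen_ord (leqnSn n) i))).
by apply/funext => x; rewrite big_ord_recr.
Qed.

Lemma ipmu_ge0 f : 0 <= ipmu V f f.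
Proof. by apply: mean_ge0 => x; rewrite -expr2 sqr_ge0. Qed.

Definition nrm f : R := Num.sqrt (ipmu V f f).

Lemma nrm_ge0 f : 0 <= nrm f.
Proof. exact: sqrtr_ge0. Qed.

Lemma sqr_nrm f : nrm f ^+ 2 = ipmu V f f.
Proof. by rewrite sqr_sqrtr ?ipmu_ge0. Qed.

Lemma ipmu_sqrD f g t : L2mu V f -> L2mu V g ->
  ipmu V (fun x => f x + t * g x) (fun x => f x + t * g x) =
  ipmu V f f + 2 * t * ipmu V f g + t ^+ 2 * ipmu V g g.
Proof.
move=> hf hg; have htg := L2muZ t hg; have hs := L2muD hf htg.
rewrite ipmuDl// ipmuZl// [ipmu V f (fun _ => _)]ipmuC [ipmu V g (fun _ => _)]ipmuC.
rewrite (ipmuDl hf htg hf) (ipmuDl hf htg hg) !(ipmuZl _ hg)// (ipmuC g f).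
by ring.
Qed.

(** The quadratic polynomial [t -> |f + t g|^2] is nonnegative, so its discriminant is not
    positive. *)
Lemma cauchy_schwarz f g : L2mu V f -> L2mu V g ->
  `|ipmu V f g| <= nrm f * nrm g.
Proof.
move=> hf hg.
have q t : 0 <= ipmu V f f + 2 * t * ipmu V f g + t ^+ 2 * ipmu V g g.
  by rewrite -ipmu_sqrD//; exact: ipmu_ge0.
rewrite /nrm -sqrtrM ?ipmu_ge0// -sqrtr_sqr ler_sqrt;
  last exact: (mulr_ge0 (ipmu_ge0 _) (ipmu_ge0 _)).
move: (ipmu_ge0 f) (ipmu_ge0 g) q.
move: (ipmu V f f) (ipmu V f g) (ipmu V g g) => a b c a0 c0 q.
move: c0; rewrite le_eqVlt => /predU1P[c0|c0].
  have [->|b0] := eqVneq b 0; first by rewrite expr0n/= mulr_ge0// -c0.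
  (* When [|g| = 0] the polynomial is affine, and this [t] would give it the value -1. *)
  have := q (- (a + 1) / (2 * b)); rewrite -c0.
  suff -> : a + 2 * (- (a + 1) / (2 * b)) * b + (- (a + 1) / (2 * b)) ^+ 2 * 0 = -1 by lra.
  by field.
(* The minimiser of the polynomial. *)
have := q (- b / c).
suff -> : a + 2 * (- b / c) * b + (- b / c) ^+ 2 * c = (a * c - b ^+ 2) / c.
  by rewrite pmulr_lge0 ?invr_gt0// subr_ge0.
by field; rewrite gt_eqF.
Qed.

Lemma nrmD f g : L2mu V f -> L2mu V g ->
  nrm (fun x => f x + g x) <= nrm f + nrm g.
Proof.
move=> hf hg; rewrite -(@ler_pXn2r _ 2)// ?nnegrE ?addr_ge0 ?nrm_ge0//.
rewrite sqrrD !sqr_nrm.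
have -> : (fun x => f x + g x) = (fun x => f x + 1 * g x).
  by apply/funext => x; rewrite mul1r.
rewrite ipmu_sqrD// expr1n mul1r mulr1.
have := le_trans (ler_norm _) (cauchy_schwarz hf hg); lra.
Qed.

Lemma nrmZ c f : L2mu V f -> nrm (fun x => c * f x) = `|c| * nrm f.
Proof.
move=> hf; rewrite /nrm ipmuZl// 1?ipmuC ?ipmuZl//; try exact: L2muZ.
by rewrite mulrA -expr2 sqrtrM ?sqr_ge0// sqrtr_sqr.
Qed.

Lemma nrm_sum n (c : 'I_n -> R) (f : 'I_n -> R -> R) : (forall i, L2mu V (f i)) ->
  nrm (fun x => \sum_(i < n) c i * f i x) <= \sum_(i < n) `|c i| * nrm (f i).
Proof.
elim: n c f => [|n IH] c f hf.
  rewrite big_ord0 (_ : (fun x => _) = fun=> 0) /nrm ?ipmu0l ?sqrtr0//.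
  by apply/funext => x; rewrite big_ord0.
rewrite big_ord_recr/= (_ : (fun x => _) = fun x =>
  (\sum_(i < n) c (widen_ord (leqnSn n) i) * f (widen_ord (leqnSn n) i) x) +
  c ord_max * f ord_max x).
  have h1 := L2mu_sum (fun i => L2muZ (c (widen_ord (leqnSn n) i)) (hf (widen_ord (leqnSn n) i))).
  rewrite (le_trans (nrmD h1 (L2muZ _ (hf _))))// nrmZ// lerD2r.
  exact: (IH (fun i => c (widen_ord (leqnSn n) i)) (fun i => f (widen_ord (leqnSn n) i))).
by apply/funext => x; rewrite big_ord_recr.
Qed.

Lemma nrmB_ge f g : L2mu V f -> L2mu V g ->
  nrm f <= nrm g + nrm (fun x => f x - g x).
Proof.
move=> hf hg; rewrite {1}(_ : f = fun x => g x + (f x - g x)).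
  by apply: nrmD => //; exact: L2muB.
by apply/funext => x; rewrite addrC subrK.
Qed.

End WeightedL2.

(** * Density of compactly supported continuous functions *)

Section DensityInL2.
Variables (R : realType) (V : R -> R).
Hypothesis cV : continuous V.
Hypothesis hZ : (\int[@lebesgue_measure R]_x (wgt V x)%:E < +oo)%E.
Implicit Types (f g h u : R -> R) (x c m e : R).
Notation leb := (@lebesgue_measure R).

(** Dominated convergence for the squares, with [g^2] as majorant; the square root is continuous at
    0. *)
Lemma nrm_dominated_cvg (u : nat -> R -> R) g :
  (forall k, measurable_fun setT (u k)) -> L2mu V g ->
  (forall k x, `|u k x| <= g x) -> (forall x, u ^~ x @ \oo --> (0 : R)) ->
  (fun k => nrm V (u k)) @ \oo --> (0 : R).
Proof.
move=> mu gL ug u0; have [_ Ig] := (L2muP cV _).1 gL.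
pose F k x := (u k x ^+ 2 * wgt V x)%:E.
have mF k : measurable_fun setT (F k).
  apply/measurable_EFinP; apply: measurable_funM; last exact: measurable_wgt.
  exact: measurable_funX.
have F0 x : F ^~ x @ \oo --> (cst 0%E : R -> \bar R) x.
  apply: cvg_EFin; first exact: nearW.
  rewrite -[X in _ --> X](mul0r (wgt V x)); apply: cvgMr_tmp.
  by rewrite -[X in _ --> X](mulr0 0); apply: cvgM.
have FG k x : (`|F k x| <= (g x ^+ 2 * wgt V x)%:E)%E.
  rewrite lee_fin normrM (ger0_norm (wgt_ge0 _ _)) ler_wpM2r ?wgt_ge0// normrX.
  by rewrite lerXn2r// ?nnegrE// (le_trans _ (ug k x)).
have [||||_ _ H] := @dominated_convergence _ _ R leb setT measurableT F (cst 0%E)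
    (fun x => (g x ^+ 2 * wgt V x)%:E) mF.
- exact: measurable_cst.
- by apply: aeW => x _; exact: F0.
- exact: Ig.
- by apply: aeW => x k _; exact: FG.
rewrite integral0 in H.
have {}H : (fun k => fine (\int[leb]_x F k x) / Zc V) @ \oo --> (0 : R).
  by rewrite -[X in _ --> X](mul0r (Zc V)^-1); apply: cvgMr_tmp; exact: fine_cvg H.
rewrite -[X in _ --> X]sqrtr0 /nrm; apply: continuous_cvg; first exact: sqrt_continuous.
apply: cvg_trans H; apply: near_eq_cvg; apply: nearW => k /=.
by rewrite /ipmu; congr (fine _ / _); apply: eq_integral => x _; rewrite /F expr2.
Qed.

Definition clip c x : R := Num.max (- c) (Num.min c x).

Lemma clip_bound c x : 0 <= c -> `|clip c x| <= c.
Proof.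
by move=> c0; rewrite ler_norml /clip le_max lexx ge_max ge_min lexx/= andbT ge0_cp.
Qed.

Lemma clip_le_norm c x : 0 <= c -> `|clip c x| <= `|x|.
Proof.
move=> c0; rewrite /clip; have [cx|xc] := leP c x.
  by rewrite (le_trans _ (ler_norm x))// (le_trans _ cx)// /Num.max; case: ifP => _;
    rewrite ?normrN (ger0_norm c0).
rewrite /Num.max; case: ifP => //; rewrite ltNge => /negbFE xc'.
by rewrite normrN ger0_norm// ler_normr lerNr xc' orbT.
Qed.

(** Clipping is the nearest-point projection onto [[-c, c]], an interval that contains [y]. *)
Lemma clip_dist c x y : `|y| <= c -> `|y - clip c x| <= `|y - x|.
Proof.
rewrite ler_norml => /andP[cy yc].
have := ler_norm (y - x); have := ler_norm (- (y - x)); rewrite normrN.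
move: (`|y - x|) => d h1 h2; rewrite ler_norml /clip.
have [cx|xc] := leP c x.
  by have [cc|cc] := leP c (- c); apply/andP; split; lra.
by have [xc'|xc'] := leP x (- c); apply/andP; split; lra.
Qed.

Lemma continuous_clip c : continuous (clip c).
Proof.
move=> x; rewrite /clip; apply: (@continuous_max _ _ (fun=> - c) (fun x => Num.min c x)).
  exact: cvg_cst.
by apply: (@continuous_min _ _ (fun=> c) id); [exact: cvg_cst|exact: cvg_id].
Qed.

(* Since Lebesgue-approximation is available in L1 only, a bounded function is
   approximated in L1 by continuous functions, which are then cut off at the
   bound [m]: then the square of the error is at most [2 m] times the error. *)
Lemma dense_Cc_bounded f m e : 0 < m -> measurable_fun setT f ->
  (forall x, `|f x| <= m) -> (forall x, m < `|x| -> f x = 0) -> 0 < e ->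
  exists g, [/\ continuous g, compact_supp g & nrm V (fun x => f x - g x) < e].
Proof.
move=> m0 mf fm fsupp e0.
pose E : set R := [set` `[- (m + 1), m + 1]].
have [K [_ hK]] := compact_bounded (continuous_compact
  (@continuous_subspaceT _ _ E (wgt V) (continuous_wgt cV))
  (@segment_compact _ (- (m + 1)) (m + 1))).
pose B := `|K| + 1.
have B0 : 0 < B by rewrite ltr_wpDl.
have wB x : E x -> wgt V x <= B.
  move=> Ex; rewrite (le_trans (ler_norm _))//; apply: (hK B); last by exists x.
  by rewrite (le_lt_trans (ler_norm K))// ltrDl.
have mE : measurable E by exact: measurable_itv.
have Ef : (leb E < +oo)%E.
  by rewrite /E lebesgue_measure_itv/=; case: ifP => _; rewrite -?EFinB ltry.
have If : leb.-integrable E (EFin \o f).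
  apply: measurable_bounded_integrable => //; first exact: measurable_funS mf.
  exists m; split; first exact: num_real.
  by move=> y my x _; apply: le_trans (fm x) (ltW my).
have [p [cp Ip]] := approximation_continuous_integrable mE Ef If.
(* An L1 error below [d] on [E], where the weight is at most [B], makes the squared norm at most
   [2 m B d / Zc V]; the added 1 puts this strictly below [e^2]. *)
pose d := e ^+ 2 / (2 * m * B * ((Zc V)^-1 + 1)).
have Zi : 0 <= (Zc V)^-1 by rewrite invr_ge0 Zc_ge0.
have mB : 0 < 2 * m * B by rewrite !mulr_gt0.
have d0 : 0 < d by rewrite divr_gt0 ?exprn_gt0// mulr_gt0// ltr_wpDl.
move=> /fine_cvgP[finp cvgp].
have [n [fin_n lt_n]] := filter_ex (@filterI _ _ eventually_filter _ _ finp (cvgr_lt _ cvgp _ d0)).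
move: fin_n lt_n => /= fin_n lt_n.
move: (p n) (cp n) (Ip n) fin_n lt_n => q cq Iq fin_q lt_q {p cp Ip finp cvgp}.
(* A continuous cutoff that differs from 1 only where [f] already vanishes. *)
pose tent x : R := Num.max 0 (Num.min 1 (m + 1 - `|x|)).
have ctent : continuous tent.
  move=> x; apply: (@continuous_max _ _ (fun=> 0) (fun x => Num.min 1 (m + 1 - `|x|))).
    exact: cvg_cst.
  apply: (@continuous_min _ _ (fun=> 1) (fun x => m + 1 - `|x|)); first exact: cvg_cst.
  by apply: cvgB; [exact: cvg_cst|exact: norm_continuous].
have tent1 x : `|x| <= m -> tent x = 1.
  by move=> xm; rewrite /tent; have [h|h] := leP 1 (m + 1 - `|x|); rewrite ?max_r//; lra.
have tent0 x : m + 1 <= `|x| -> tent x = 0.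
  move=> xm; rewrite /tent max_l// ge_min; apply/orP; right; lra.
have tent01 x : 0 <= tent x <= 1 by rewrite /tent le_max lexx/= ge_max ler01 ge_min lexx.
pose g x := tent x * clip m (q x).
have cg : continuous g.
  move=> x; apply: cvgM; first exact: ctent.
  by apply: (@continuous_comp _ _ _ q (clip m)); [exact: cq|exact: continuous_clip].
exists g; split => //.
  by exists (m + 1) => x /ltW xm; rewrite /g tent0// mul0r.
have gm x : `|g x| <= m.
  rewrite /g normrM; case/andP: (tent01 x) => t0 t1; rewrite (ger0_norm t0).
  by have := clip_bound (q x) (ltW m0); have := normr_ge0 (clip m (q x)); nra.
have Dm x : `|f x - g x| <= 2 * m.
  by rewrite (le_trans (ler_normB _ _))// mulr2n mulrDl !mul1r lerD.
(* Inside [[-m, m]] the tent is 1 and clipping takes [q x] no farther from [f x]; outside, [f x = 0]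
   and [|g x| <= |q x|]. *)
have Dq x : `|f x - g x| <= `|f x - q x|.
  have [xm|mx] := leP `|x| m; first by rewrite /g tent1// mul1r clip_dist.
  rewrite fsupp// !sub0r !normrN /g normrM; case/andP: (tent01 x) => t0 t1.
  rewrite (ger0_norm t0) (le_trans _ (clip_le_norm (q x) (ltW m0)))//.
  by rewrite ler_piMl.
have D0 x : ~ E x -> f x - g x = 0.
  rewrite /E /= in_itv/= => /negP; rewrite -ler_norml -ltNge => mx.
  rewrite /g tent0 ?ltW// mul0r subr0 fsupp//.
  by apply: lt_trans mx; rewrite ltrDl.
pose D x := ((f x - g x) * (f x - g x) * wgt V x)%:E.
have mD : measurable_fun setT D.
  have mfg : measurable_fun setT (fun x => f x - g x).
    by apply: measurable_funB => //; exact: continuous_measurable_fun.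
  apply/measurable_EFinP; apply: measurable_funM; last exact: measurable_wgt.
  exact: measurable_funM.
have mq : measurable_fun E (fun x => `|(f x - q x)%:E|%E).
  apply: measurableT_comp => //; apply/measurable_EFinP.
  apply: measurable_funB; first exact: measurable_funS mf.
  by apply: measurable_funS (continuous_measurable_fun cq).
have DE : (\int[leb]_x D x = \int[leb]_(x in E) D x)%E.
  rewrite [RHS](@integral_mkcond _ _ R leb E D); apply: eq_integral => x _.
  rewrite patchE; case: ifPn => //; rewrite notin_setE => Ex.
  by rewrite /D D0// mul0r mul0r.
have le_int : (\int[leb]_x D x <= (2 * m * B)%:E *
    \int[leb]_(x in E) `|(f x - q x)%:E|)%E.
  rewrite DE -(@ge0_integralZl_EFin _ _ R leb E) //; last exact: ltW.
  apply: ge0_le_integral => //.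
  - by move=> x _; rewrite lee_fin mulr_ge0 ?wgt_ge0// -expr2 sqr_ge0.
  - exact: measurable_funS mD.
  - exact: measurable_funeM.
  - move=> x Ex; rewrite -EFinM lee_fin [leRHS]mulrAC.
    apply: ler_pM; [by rewrite -expr2 sqr_ge0|exact: wgt_ge0| |exact: wB].
    rewrite (le_trans (ler_norm _))// normrM.
    exact: ler_pM (normr_ge0 _) (normr_ge0 _) (Dm x) (Dq x).
rewrite -(@ltr_pXn2r _ 2)// ?nnegrE ?nrm_ge0 ?(ltW e0)// sqr_nrm /ipmu.
have I0 : (0 <= \int[leb]_x D x)%E.
  by apply: integral_ge0 => x _; rewrite lee_fin mulr_ge0 ?wgt_ge0// -expr2 sqr_ge0.
have : fine (\int[leb]_x D x) <= 2 * m * B * d.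
  rewrite -(fineK fin_q) -EFinM in le_int; move: I0 le_int.
  case: (\int[leb]_x D x)%E => [r|//|//] _; rewrite lee_fin => /le_trans; apply.
  by rewrite ler_pM2l// ltW.
move=> /(ler_wpM2r Zi) /le_lt_trans; apply; rewrite /d.
rewrite -(@ltr_pM2r _ ((Zc V)^-1 + 1)) ?ltr_wpDl//.
have -> : 2 * m * B * (e ^+ 2 / (2 * m * B * ((Zc V)^-1 + 1))) / Zc V * ((Zc V)^-1 + 1)
   = e ^+ 2 / Zc V.
  move: (Zc V)^-1 Zi mB => z z0 mB; field.
  by rewrite !gt_eqF//= ?ltr_wpDl.
by rewrite ltr_pM2l ?exprn_gt0// ltrDl.
Qed.

(** Truncating [f] to the points where both [|x|] and [|f x|] are at most [k + 1] leaves an error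
    that tends to 0 by dominated convergence, and brings [f] within reach of the bounded case. *)
Lemma dense_Cc f e : L2mu V f -> 0 < e ->
  exists g, [/\ continuous g, compact_supp g & nrm V (fun x => f x - g x) < e].
Proof.
move=> fL e0; have mf := L2mu_measurable fL.
pose A (k : nat) : set R := [set` `[- k.+1%:R, k.+1%:R]] `&` (f @^-1` [set` `[- k.+1%:R, k.+1%:R]]).
have mA k : measurable (A k).
  apply: measurableI; first exact: measurable_itv.
  by rewrite -[X in measurable X]setTI; apply: mf => //; exact: measurable_itv.
pose t (k : nat) x := f x * \1_(A k) x.
have mt k : measurable_fun setT (t k).
  by apply: measurable_funM => //; exact: measurable_indic.
have AP k x : A k x <-> `|x| <= k.+1%:R /\ `|f x| <= k.+1%:R.
  by rewrite /A /= !in_itv/= -!ler_norml.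
have tA k x : A k x -> t k x = f x by move=> Ax; rewrite /t indicE mem_set// mulr1.
have tNA k x : ~ A k x -> t k x = 0 by move=> Ax; rewrite /t indicE memNset// mulr0.
have tL k : L2mu V (t k).
  apply: (L2mu_bounded cV hZ (mt k) (c := k.+1%:R)) => x.
  by have [Ax|Ax] := pselect (A k x); [rewrite tA//; case: ((AP k x).1 Ax)|rewrite tNA// normr0].
have cvg : (fun k => nrm V (fun x => f x - t k x)) @ \oo --> (0 : R).
  apply: (@nrm_dominated_cvg _ (fun x => `|f x|)).
  - by move=> k; apply: measurable_funB.
  - apply/(L2muP cV); split; first exact: measurableT_comp.
    have [_] := (L2muP cV f).1 fL; congr mu_integrable; apply/funext => x.
    by rewrite real_normK// num_real.
  - move=> k x; have [Ax|Ax] := pselect (A k x); first by rewrite tA// subrr normr0.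
    by rewrite tNA// subr0.
  - move=> x; apply: cvg_near_cst.
    have [N hN] : exists N : nat, `|x| + `|f x| < N%:R.
      by exists (Num.truncn (`|x| + `|f x|)).+1; exact: truncnS_gt.
    exists N => // k /= Nk; rewrite tA ?subrr//; apply/AP.
    have : N%:R <= k.+1%:R :> R by rewrite ler_nat; exact: leq_trans Nk (leqnSn k).
    by have := normr_ge0 x; have := normr_ge0 (f x); split; lra.
have e2 : 0 < e / 2 by rewrite divr_gt0.
have [k hk] := filter_ex (cvgr_lt _ cvg _ e2).
have [] := @dense_Cc_bounded (t k) k.+1%:R (e / 2) _ (mt k) _ _ e2.
- by rewrite ltr0n.
- move=> x; have [Ax|Ax] := pselect (A k x); last by rewrite tNA// normr0.
  by rewrite tA//; case: ((AP k x).1 Ax).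
- move=> x kx; rewrite tNA//; apply: contraPnot kx => /AP[+ _].
  by rewrite leNgt => /negP.
move=> g [cg sg gk]; exists g; split => //.
have gL := L2mu_Cc cV hZ cg sg.
have -> : (fun x => f x - g x) = fun x => (f x - t k x) + (t k x - g x).
  by apply/funext => x; ring.
rewrite (le_lt_trans (nrmD cV _ _))//; [exact: L2muB|exact: L2muB|].
by rewrite /= in hk; lra.
Qed.

End DensityInL2.

(** * Integration by parts and the adjoint of the derivative *)

Section IntegrationByParts.
Variables (R : realType) (V : R -> R).
Hypothesis sV : smooth V.
Hypothesis hZ : (\int[@lebesgue_measure R]_x (wgt V x)%:E < +oo)%E.
Implicit Types (f g h u w F : R -> R) (x c : R).
Notation leb := (@lebesgue_measure R).
Let cV : continuous V := smooth_continuous sV.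

Lemma is_derive_wgt x : is_derive x (1 : R) (wgt V) (- derive1 V x * wgt V x).
Proof. by apply: is_derive_exp; apply: is_derive_opp; exact: smooth_is_derive. Qed.

Lemma is_derive_continuous f df : (forall x, is_derive x (1 : R) f (df x)) ->
  continuous f.
Proof.
move=> fdf x; apply: differentiable_continuous.
by apply/derivable1_diffP; have [] := fdf x.
Qed.

(** Times the weight, the integrand is the derivative of [f wgt], which has compact support. *)
Lemma mean_divergence f df : (forall x, is_derive x (1 : R) f (df x)) ->
  continuous df -> compact_supp f ->
  mean V (fun x => df x - derive1 V x * f x) = 0.
Proof.
move=> fdf cdf sf.
suff E : \int[leb]_x ((df x - derive1 V x * f x) * wgt V x) = 0.
  by rewrite /mean -[fine _]/(\int[leb]_x _) E mul0r.
apply: (@Rintegral_derive_eq0 _ (fun x => f x * wgt V x)).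
- move=> x; have h := is_derive_mul (fdf x) (is_derive_wgt x).
  by apply: is_derive_eq h _; ring.
- move=> x; apply: cvgM; last exact: continuous_wgt.
  apply: cvgB; first exact: cdf.
  apply: cvgM; first exact: (smooth_continuous (smooth_derive1 sV)).
  exact: (is_derive_continuous fdf).
- exact: compact_suppM.
Qed.

Lemma mu_integrable_Cc f : continuous f -> compact_supp f -> mu_integrable V f.
Proof.
move=> cf sf; have := L2muM_integrable cV (L2mu_cst cV hZ 1) (L2mu_Cc cV hZ cf sf).
by congr mu_integrable; apply/funext => x; rewrite mul1r.
Qed.

Lemma mu_integrable_Cc_inf f : Cc_inf f -> mu_integrable V f.
Proof. by move=> [sf]; apply: mu_integrable_Cc; exact: smooth_continuous sf. Qed.

(** The divergence identity for [F w], whose compact support comes from [w]. The C^1 form is meant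
    for solutions [w] of the adjoint equation with a merely continuous right-hand side. *)
Lemma ipmu_adjoint F dF w dw :
  (forall x, is_derive x (1 : R) F (dF x)) -> continuous dF ->
  (forall x, is_derive x (1 : R) w (dw x)) -> continuous dw -> compact_supp w ->
  ipmu V F (fun x => - dw x + derive1 V x * w x) = ipmu V dF w.
Proof.
move=> hF cdF hw cdw sw.
have cF := is_derive_continuous hF; have cw := is_derive_continuous hw.
have sdw : compact_supp dw by rewrite -(derive1_eq hw); exact: compact_supp_derive1.
have cV' := smooth_continuous (smooth_derive1 sV).
have h x := is_derive_mul (hF x) (hw x).
have := mean_divergence h _ (compact_suppMr _ sw).
have -> : (fun x => dF x * w x + F x * dw x - derive1 V x * (F x * w x)) =
  fun x => dF x * w x + -1 * (F x * (- dw x + derive1 V x * w x)).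
  by apply/funext => x; ring.
rewrite meanD ?meanZ//.
- rewrite mulN1r => /(_ _) H; apply/esym/eqP; rewrite -subr_eq0; apply/eqP; apply: H.
  by move=> x; apply: cvgD; apply: cvgM; [exact: cdF|exact: cw|exact: cF|exact: cdw].
- apply: mu_integrable_Cc.
    move=> x; apply: cvgM; first exact: cF.
    by apply: cvgD; [apply: cvgN; exact: cdw|apply: cvgM; [exact: cV'|exact: cw]].
  apply: compact_suppMr; apply: compact_suppD; first exact: compact_suppN.
  exact: compact_suppMr.
- apply: mu_integrable_Cc; last exact: compact_suppMr.
  by move=> x; apply: cvgM; [exact: cdF|exact: cw].
- apply: mu_integrableZ.
  apply: mu_integrable_Cc.
    move=> x; apply: cvgM; first exact: cF.
    by apply: cvgD; [apply: cvgN; exact: cdw|apply: cvgM; [exact: cV'|exact: cw]].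
  apply: compact_suppMr; apply: compact_suppD; first exact: compact_suppN.
  exact: compact_suppMr.
Qed.

Definition adj w x : R := - derive1 w x + derive1 V x * w x.

Lemma Cc_inf_adj w : Cc_inf w -> Cc_inf (adj w).
Proof.
move=> hw; apply: Cc_infD; last exact: (Cc_infM (smooth_derive1 sV) hw).
have [sw cw] := Cc_inf_derive1 hw.
by split; [exact: smoothN|exact: compact_suppN].
Qed.

Lemma ipmu_adj F w : smooth F -> Cc_inf w -> ipmu V F (adj w) = ipmu V (derive1 F) w.
Proof.
move=> sF [sw cw]; exact: (ipmu_adjoint (fun x => smooth_is_derive x sF)
  (smooth_continuous (smooth_derive1 sF)) (fun x => smooth_is_derive x sw)
  (smooth_continuous (smooth_derive1 sw)) cw).
Qed.

Lemma Lop_adj f : Lop V f = fun x => - adj (derive1 f) x.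
Proof. by apply/funext => x; rewrite /Lop /adj; ring. Qed.

Lemma Cc_inf_Lop f : Cc_inf f -> Cc_inf (Lop V f).
Proof.
move=> hf; rewrite Lop_adj; have [sf cf] := Cc_inf_adj (Cc_inf_derive1 hf).
by split; [exact: smoothN|exact: compact_suppN].
Qed.

Lemma ipmu_Lop f : Cc_inf f -> - ipmu V f (Lop V f) = ipmu V (derive1 f) (derive1 f).
Proof.
move=> hf; rewrite -(ipmu_adj (proj1 hf) (Cc_inf_derive1 hf)) Lop_adj.
have hf' := L2mu_Cc_inf cV hZ (Cc_inf_adj (Cc_inf_derive1 hf)).
rewrite ipmuC (_ : (fun x => - adj _ x) = (fun x => -1 * adj (derive1 f) x)).
  by rewrite (ipmuZl cV (-1) hf' (L2mu_Cc_inf cV hZ hf)) mulN1r opprK ipmuC.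
by apply/funext => x; rewrite mulN1r.
Qed.

(** The commutation of the derivative with its adjoint, in quadratic form. The square is
    [w'^2 - 2 V' w w' + V'^2 w^2]; adding the mean-zero divergence [2 V' w w' + V'' w^2 - V'^2 w^2]
    of [w^2 V'] leaves [w'^2 + V'' w^2]. *)
Lemma ipmu_adj_adj w : Cc_inf w -> ipmu V (adj w) (adj w) =
  ipmu V (derive1 w) (derive1 w) +
  mean V (fun x => derive1 (derive1 V) x * (w x * w x)).
Proof.
move=> hw; have [sw cw] := hw.
have sw' := smooth_derive1 sw; have sV' := smooth_derive1 sV.
have sV'' := smooth_derive1 sV'.
pose F x := (w x * w x) * derive1 V x.
pose dF x := (derive1 w x * w x + w x * derive1 w x) * derive1 V x +
  w x * w x * derive1 (derive1 V) x.
have hF x : is_derive x (1 : R) F (dF x).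
  by apply: is_derive_mul; [apply: is_derive_mul|]; exact: smooth_is_derive.
have sdF : smooth dF := smoothD (smoothM (smoothD (smoothM sw' sw) (smoothM sw sw')) sV')
  (smoothM (smoothM sw sw) sV'').
have hF0 : Cc_inf F.
  by split; [exact: smoothM (smoothM sw sw) sV'|exact: compact_suppM (compact_suppM _ cw)].
have hdF : Cc_inf dF by rewrite -(derive1_eq hF); exact: Cc_inf_derive1.
have E0 := mean_divergence hF (smooth_continuous sdF) (proj2 hF0).
have hA := Cc_inf_adj hw; have hw' := Cc_inf_derive1 hw.
have I1 := mu_integrable_Cc_inf (Cc_infM (proj1 hA) hA).
have I2 : mu_integrable V (fun x => dF x - derive1 V x * F x).
  apply: mu_integrable_Cc_inf; apply: (Cc_infD hdF).
  by have [sG cG] := Cc_infM sV' hF0; split; [exact: smoothN sG|exact: compact_suppN].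
have I3 := mu_integrable_Cc_inf (Cc_infM (proj1 hw') hw').
have I4 := mu_integrable_Cc_inf (Cc_infM sV'' (Cc_infM sw hw)).
rewrite !ipmuE -[LHS]addr0 -E0 -(meanD I1 I2) -(meanD I3 I4).
by apply: mean_eq => x; rewrite /adj /dF /F; ring.
Qed.

(** As [fine] sends an infinite integral to 0, finiteness matters. Up to a bound [c] of the bump,
    [Zc V] dominates the positive integral of the bump against the weight. *)
Lemma Zc_gt0 : 0 < Zc V.
Proof.
have [sb cb] := @Cc_inf_bump_fun R.
have [c bc] := continuous_compact_supp_bounded (smooth_continuous sb) cb.
have cw := continuous_wgt cV.
have Iw : leb.-integrable setT (EFin \o wgt V).
  have := mu_integrable1 cV hZ; rewrite /mu_integrable.
  by rewrite (_ : (fun x => 1 * wgt V x) = wgt V)//; apply/funext => x; rewrite mul1r.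
have sbw := compact_suppM (wgt V) cb.
have cbw : continuous (fun x => @bump_fun R x * wgt V x).
  by move=> x; apply: cvgM; [exact: (smooth_continuous sb)|exact: cw].
have : 0 < \int[leb]_x (@bump_fun R x * wgt V x).
  apply: (@Rintegral_gt0 _ _ (2^-1)) => //.
    by move=> y; rewrite mulr_ge0 ?bump_fun_ge0 ?wgt_ge0.
  by rewrite mulr_gt0 ?wgt_gt0// bump_fun_gt0//; lra.
move=> /lt_le_trans => /(_ (c * Zc V)) h; have {}h : 0 < c * Zc V.
  apply: h; rewrite /Zc -[fine _]/(\int[leb]_x wgt V x) -RintegralZl//.
  apply: le_Rintegral => //.
  - exact: (Cc_integrable cbw sbw).
  - by have := integrableZl measurableT c Iw.
  - by move=> x _; rewrite ler_wpM2r ?wgt_ge0// (le_trans (ler_norm _)).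
have c0 : 0 <= c by apply: le_trans (bc 0).
by rewrite ltNge; apply/negP => Z0; have := ler_wpM2l c0 Z0; rewrite mulr0 leNgt h.
Qed.

Lemma ipmu_gt0 f x : continuous f -> compact_supp f -> f x != 0 -> 0 < ipmu V f f.
Proof.
move=> cf sf fx; rewrite /ipmu divr_gt0 ?Zc_gt0//.
apply: (@Rintegral_gt0 _ (fun x => f x * f x * wgt V x) x).
- by move=> y; apply: cvgM; [apply: cvgM; exact: cf|exact: continuous_wgt].
- by apply: compact_suppM; exact: compact_suppM.
- by move=> y; rewrite mulr_ge0 ?wgt_ge0// -expr2 sqr_ge0.
- by rewrite mulr_gt0 ?wgt_gt0// -expr2 exprn_even_gt0.
Qed.

(** The equation [- w' + V' w = u] reads [(w e^(-V))' = - u e^(-V)]; this is its solution that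
    vanishes to the left of the support of [u]. It has compact support when [u] has mean zero. *)
Definition adj_inv u x : R := - (primitive (fun t => u t * wgt V t) x * expR (V x)).

Lemma compact_supp_adj_inv u : compact_supp u -> mean V u = 0 ->
  compact_supp (adj_inv u).
Proof.
move=> su u0; apply: compact_suppN; apply: compact_suppM.
apply: compact_supp_primitive; first exact: compact_suppM.
move/eqP: u0; rewrite /mean mulf_eq0 invr_eq0 (gt_eqF Zc_gt0) orbF.
by move/eqP.
Qed.

Lemma is_derive_adj_inv u x : continuous u -> compact_supp u ->
  is_derive x (1 : R) (adj_inv u) (- u x + derive1 V x * adj_inv u x).
Proof.
move=> cu su.
have cuw : continuous (fun t => u t * wgt V t).
  by move=> y; apply: cvgM; [exact: cu|exact: continuous_wgt].
have h := is_derive_opp (is_derive_mul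
  (is_derive_primitive x cuw (compact_suppM _ su))
  (is_derive_exp (smooth_is_derive x sV))).
apply: is_derive_eq h _; rewrite /adj_inv /wgt -mulrA -expRD addNr expR0.
by ring.
Qed.

Lemma Cc_inf_adj_inv u : Cc_inf u -> mean V u = 0 -> Cc_inf (adj_inv u).
Proof.
move=> [su cu] u0; split; last exact: compact_supp_adj_inv.
have suw : smooth (fun t => u t * wgt V t) := smoothM su (smooth_exp (smoothN sV)).
exact: smoothN (smoothM (smooth_primitive suw (compact_suppM _ cu)) (smooth_exp sV)).
Qed.

End IntegrationByParts.

(** * Rayleigh quotients under orthogonality constraints *)

Section ConstrainedRayleigh.
Variables (R : realType) (V : R -> R).
Hypothesis sV : smooth V.
Hypothesis hZ : (\int[@lebesgue_measure R]_x (wgt V x)%:E < +oo)%E.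
Implicit Types (f g h u w F : R -> R) (x c a b : R).
Notation leb := (@lebesgue_measure R).
Let cV : continuous V := smooth_continuous sV.

Definition combination n (c : 'I_n -> R) (phi : 'I_n -> R -> R) x : R :=
  \sum_(i < n) c i * phi i x.

Lemma L2mu_combination n (c : 'I_n -> R) phi : (forall i, L2mu V (phi i)) ->
  L2mu V (combination c phi).
Proof. by move=> hp; apply: (L2mu_sum cV hZ) => i; exact: (L2muZ cV (c i) (hp i)). Qed.

Lemma Cc_inf_combination n (c : 'I_n -> R) phi : (forall i, Cc_inf (phi i)) ->
  Cc_inf (combination c phi).
Proof. by move=> hp; apply: Cc_inf_sum => i; exact: Cc_infZ (hp i). Qed.

Lemma ipmu_combination n (c : 'I_n -> R) phi h : (forall i, L2mu V (phi i)) ->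
  L2mu V h -> ipmu V (combination c phi) h = \sum_(i < n) c i * ipmu V (phi i) h.
Proof.
move=> hp hh; rewrite /combination.
rewrite (ipmu_suml cV hZ (fun i => L2muZ cV (c i) (hp i)) hh).
by apply: eq_bigr => i _; exact: (ipmuZl cV (c i) (hp i) hh).
Qed.

Lemma derive1_combination n (c : 'I_n -> R) phi : (forall i, Cc_inf (phi i)) ->
  derive1 (combination c phi) = combination c (fun i => derive1 (phi i)).
Proof.
move=> hp; rewrite /combination (derive1_sum (fun i => @smoothZ _ (c i) _ (proj1 (hp i)))).
by apply/funext => x; apply: eq_bigr => i _; rewrite (@derive1Z _ _ _ (proj1 (hp i))).
Qed.

(** For [phi] dual to [g], the oblique projection of [f] onto the functions orthogonal to every
    [g i]. *)
Definition residual n (g phi : 'I_n -> R -> R) f x : R :=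
  f x - combination (fun i => ipmu V f (g i)) phi x.

Lemma Cc_infB f g : Cc_inf f -> Cc_inf g -> Cc_inf (fun x => f x - g x).
Proof.
move=> hf [sg cg]; apply: (Cc_infD hf).
by split; [exact: smoothN sg|exact: compact_suppN].
Qed.

Lemma Cc_inf_residual n (g phi : 'I_n -> R -> R) f : (forall i, Cc_inf (phi i)) ->
  Cc_inf f -> Cc_inf (residual g phi f).
Proof. by move=> hp hf; apply: (Cc_infB hf); exact: Cc_inf_combination. Qed.

(* The family [phi] is dual to [g] as far as the (possibly dependent)
   functionals [ipmu V _ (g i)] on test functions allow. *)
Lemma exists_dual_family n (g : 'I_n -> R -> R) : (forall i, L2mu V (g i)) ->
  exists phi : 'I_n -> R -> R, (forall i, Cc_inf (phi i)) /\
    forall f, Cc_inf f -> forall j, ipmu V (residual g phi f) (g j) = 0.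
Proof.
elim: n g => [|n IH] g gL; first by exists (fun _ _ => 0); split=> [[]|f _ []].
pose g' i := g (lift ord0 i).
have [phi [hphi phi0]] := IH g' (fun i => gL _).
have rL f : Cc_inf f -> Cc_inf (residual g' phi f) by exact: Cc_inf_residual.
have CL := L2mu_Cc_inf cV hZ.
have comb_recl (c : 'I_n.+1 -> R) (p : 'I_n.+1 -> R -> R) x : combination c p x =
    c ord0 * p ord0 x + combination (fun i => c (lift ord0 i)) (fun i => p (lift ord0 i)) x.
  by rewrite /combination big_ord_recl.
(* Either some residual for the last [n] constraints is seen by [g ord0], or the first functional
   depends on the others and its dual function can be 0. *)
have [[f0 [hf0 f0n]]|triv] := pselect (exists f0, Cc_inf f0 /\
    ipmu V (residual g' phi f0) (g ord0) != 0); last first.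
  exists (fun i => if unlift ord0 i is Some j then phi j else fun=> 0); split.
    move=> i; case: unliftP => [j _|_]; first exact: (hphi j).
    by split; [exact: smooth_cst|exists 0].
  move=> f hf; have E : residual g (fun i => if unlift ord0 i is Some j then phi j else fun=> 0) f
      = residual g' phi f.
    apply/funext => x; rewrite /residual comb_recl unlift_none mulr0 add0r.
    by congr (_ - _); apply: eq_bigr => i _; rewrite liftK.
  rewrite E => j; case: (unliftP ord0 j) => [k ->|->]; first exact: phi0.
  by apply/eqP; apply: contrapT => /negP h; apply: triv; exists f.
pose N := ipmu V (residual g' phi f0) (g ord0).
(* Pairs to 1 with [g ord0] and to 0 with the other constraints; removing its component from the old
   dual functions makes them orthogonal to [g ord0]. *)
pose psi := fun x => N^-1 * residual g' phi f0 x.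
have hpsi : Cc_inf psi := Cc_infZ N^-1 (rL _ hf0).
have psi0 : ipmu V psi (g ord0) = 1.
  by rewrite (ipmuZl cV _ (CL _ (rL _ hf0)) (gL _)) mulVf.
have psiS i : ipmu V psi (g (lift ord0 i)) = 0.
  by rewrite (ipmuZl cV _ (CL _ (rL _ hf0)) (gL _)) (phi0 _ hf0 i) mulr0.
pose phi' i := if unlift ord0 i is Some j
  then fun x => phi j x - ipmu V (phi j) (g ord0) * psi x else psi.
exists phi'; split.
  move=> i; rewrite /phi'; case: unliftP => [j _|_]; last exact: hpsi.
  exact: Cc_infB (hphi j) (Cc_infZ _ hpsi).
move=> f hf; have E : residual g phi' f =
    fun x => residual g' phi f x - ipmu V (residual g' phi f) (g ord0) * psi x.
  have -> : ipmu V (residual g' phi f) (g ord0) = ipmu V f (g ord0) -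
      \sum_(i < n) ipmu V f (g' i) * ipmu V (phi i) (g ord0).
    rewrite (ipmuBl cV (CL _ hf) (L2mu_combination _ (fun i => CL _ (hphi i))) (gL _)).
    by rewrite (ipmu_combination _ (fun i => CL _ (hphi i)) (gL _)).
  apply/funext => x; rewrite /residual comb_recl.
  have -> : combination (fun i => ipmu V f (g (lift ord0 i))) (fun i => phi' (lift ord0 i)) x =
      combination (fun i => ipmu V f (g' i)) phi x -
      (\sum_(i < n) ipmu V f (g' i) * ipmu V (phi i) (g ord0)) * psi x.
    rewrite /combination mulr_suml -sumrB; apply: eq_bigr => i _.
    by rewrite /phi' liftK /g'; ring.
  by rewrite /phi' unlift_none; ring.
have hr := CL _ (rL _ hf).
move=> j; rewrite E (ipmuBl cV hr (L2muZ cV _ (CL _ hpsi)) (gL _)).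
rewrite (ipmuZl cV _ (CL _ hpsi) (gL _)).
case: (unliftP ord0 j) => [k ->|->]; last by rewrite psi0 mulr1 subrr.
by rewrite psiS mulr0 subr0; exact: phi0.
Qed.

(** A lower bound for the constrained Rayleigh quotient of [-L], tested on the core only and with
    the denominator cleared. *)
Definition rayleigh_bound n (g : 'I_n -> R -> R) a : Prop :=
  forall f, Cc_inf f -> (forall i, ipmu V f (g i) = 0) ->
    a * ipmu V f f <= ipmu V (derive1 f) (derive1 f).

Lemma nrm_le_sqr a f g : 0 <= a -> (Num.sqrt a * nrm V f <= nrm V g) =
  (a * ipmu V f f <= ipmu V g g).
Proof.
move=> a0; rewrite -(@ler_pXn2r _ 2)// ?nnegrE ?mulr_ge0 ?sqrtr_ge0//.
by rewrite exprMn sqr_sqrtr// !sqr_nrm.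
Qed.

Let linear_perturbation (s N r f' r' c c' S1 S2 T : R) : 0 <= s -> s * r <= r' ->
  r' <= f' + c' -> N <= r + c -> c <= S1 -> c' <= S2 -> S2 + s * S1 <= T ->
  s * N <= f' + T.
Proof.
move=> s0 h1 h2 h3 h4 h5 h6.
have := ler_wpM2l s0 h3; have := ler_wpM2l s0 h4; rewrite mulrDr; lra.
Qed.

(* Quantitative form of the bound, for functions that are only almost
   orthogonal to [g]. *)
Lemma rayleigh_bound_stable n (g : 'I_n -> R -> R) a : 0 <= a ->
  (forall i, L2mu V (g i)) -> rayleigh_bound g a ->
  exists2 C, 0 <= C & forall f, Cc_inf f ->
    Num.sqrt a * nrm V f <= nrm V (derive1 f) + C * \sum_(i < n) `|ipmu V f (g i)|.
Proof.
move=> a0 gL ga; have [phi [hphi phi0]] := exists_dual_family gL.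
have CL := L2mu_Cc_inf cV hZ.
pose K i := nrm V (derive1 (phi i)) + Num.sqrt a * nrm V (phi i).
have K0 i : 0 <= K i by rewrite addr_ge0 ?mulr_ge0 ?sqrtr_ge0.
exists (\sum_(i < n) K i); first exact: sumr_ge0.
move=> f hf; pose c i := ipmu V f (g i).
have hr := Cc_inf_residual g hphi hf.
have hc : Cc_inf (combination c phi) := Cc_inf_combination c hphi.
(* The residual meets the constraints exactly; returning to [f] costs the norms of a combination
   with coefficients [ipmu V f (g i)], and of its derivative. *)
have : Num.sqrt a * nrm V (residual g phi f) <= nrm V (derive1 (residual g phi f)).
  by rewrite nrm_le_sqr//; apply: ga => // i; exact: phi0.
have E1 : (fun x => f x - residual g phi f x) = combination c phi.
  by apply/funext => x; rewrite /residual opprB addrC subrK.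
have := nrmB_ge cV (CL _ hf) (CL _ hr); rewrite E1.
have fd x : derive1 f x = derive1 (residual g phi f) x + derive1 (combination c phi) x.
  rewrite -(congr1 (fun k => k x) (derive1D (proj1 hr) (proj1 hc))); congr (derive1 _ x).
  by apply/funext => y; rewrite /residual subrK.
have E2 : (fun x => derive1 (residual g phi f) x - derive1 f x) =
    fun x => -1 * derive1 (combination c phi) x.
  by apply/funext => x; rewrite fd; ring.
have := nrmB_ge cV (CL _ (Cc_inf_derive1 hr)) (CL _ (Cc_inf_derive1 hf)).
rewrite E2 (nrmZ cV _ (CL _ (Cc_inf_derive1 hc))) normrN1 mul1r derive1_combination//.
have b1 : nrm V (combination c phi) <= \sum_(i < n) `|c i| * nrm V (phi i).
  exact: (nrm_sum cV hZ c (fun i => CL _ (hphi i))).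
have b2 : nrm V (combination c (fun i => derive1 (phi i))) <=
    \sum_(i < n) `|c i| * nrm V (derive1 (phi i)).
  exact: (nrm_sum cV hZ c (fun i => CL _ (Cc_inf_derive1 (hphi i)))).
have b3 : \sum_(i < n) `|c i| * nrm V (derive1 (phi i)) +
   Num.sqrt a * \sum_(i < n) `|c i| * nrm V (phi i) <= (\sum_(i < n) K i) * \sum_(i < n) `|c i|.
  rewrite mulr_sumr -big_split/= mulr_sumr; apply: ler_sum => i _.
  have -> : `|c i| * nrm V (derive1 (phi i)) + Num.sqrt a * (`|c i| * nrm V (phi i)) =
    K i * `|c i| by rewrite /K; ring.
  rewrite ler_wpM2r// (bigD1 i)//= lerDl; exact: sumr_ge0.
move=> H3 H2 H1; exact: linear_perturbation (sqrtr_ge0 a) H1 H3 H2 b1 b2 b3.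
Qed.

Lemma cvg_nrm_bound (p q : nat -> R) : q @ \oo --> (0 : R) ->
  (forall k, `|p k| <= q k) -> p @ \oo --> (0 : R).
Proof.
move=> q0 pq; apply/cvgr0Pnorm_le => e e0.
apply: filterS ((cvgr0Pnorm_le _).1 q0 e e0) => k; apply: le_trans.
by rewrite (le_trans (pq k))// ler_norm.
Qed.

Lemma ipmuBr f g h : L2mu V f -> L2mu V g -> L2mu V h ->
  ipmu V f (fun x => g x - h x) = ipmu V f g - ipmu V f h.
Proof.
by move=> fL gL hL; rewrite ipmuC (ipmuBl cV gL hL fL) (ipmuC V g) (ipmuC V h).
Qed.

(** From [<u,v> - <f,h> = <u-f,v-h> + <u-f,h> + <f,v-h>] and Cauchy-Schwarz. *)
Lemma cvg_ipmu (u v : nat -> R -> R) f h :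
  (forall k, L2mu V (u k)) -> (forall k, L2mu V (v k)) -> L2mu V f -> L2mu V h ->
  (fun k => nrm V (fun x => u k x - f x)) @ \oo --> (0 : R) ->
  (fun k => nrm V (fun x => v k x - h x)) @ \oo --> (0 : R) ->
  (fun k => ipmu V (u k) (v k)) @ \oo --> ipmu V f h.
Proof.
move=> uL vL fL hL uf vh.
pose A k := nrm V (fun x => u k x - f x); pose B k := nrm V (fun x => v k x - h x).
have AB : (fun k => A k * B k + A k * nrm V h + nrm V f * B k) @ \oo --> (0 : R).
  rewrite (_ : (0 : R) = 0 * 0 + 0 * nrm V h + nrm V f * 0); last by ring.
  apply: cvgD; [apply: cvgD|]; [exact: cvgM|exact: cvgMr_tmp|exact: cvgMl_tmp].
apply/subr_cvg0; apply: cvg_nrm_bound AB _ => k.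
have ufL := L2muB cV (uL k) fL; have vhL := L2muB cV (vL k) hL.
have -> : ipmu V (u k) (v k) - ipmu V f h =
    ipmu V (fun x => u k x - f x) (fun x => v k x - h x) +
    ipmu V (fun x => u k x - f x) h + ipmu V f (fun x => v k x - h x).
  rewrite (ipmuBr fL (vL k) hL) (ipmuBl cV (uL k) fL vhL) (ipmuBl cV (uL k) fL hL).
  by rewrite (ipmuBr (uL k) (vL k) hL) (ipmuBr fL (vL k) hL); ring.
rewrite (le_trans (ler_normD _ _))// lerD//; last exact: cauchy_schwarz.
by rewrite (le_trans (ler_normD _ _))// lerD//; exact: cauchy_schwarz.
Qed.

Lemma cvg_nrm (u : nat -> R -> R) f : (forall k, L2mu V (u k)) -> L2mu V f ->
  (fun k => nrm V (fun x => u k x - f x)) @ \oo --> (0 : R) ->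
  (fun k => nrm V (u k)) @ \oo --> nrm V f.
Proof.
move=> uL fL uf; apply: continuous_cvg; first exact: sqrt_continuous.
exact: cvg_ipmu.
Qed.

Lemma L2mu_nrm0_ipmu (u : nat -> R -> R) f : (forall k, L2mu V (u k)) -> L2mu V f ->
  (fun k => ipmu V (u k \- f) (u k \- f)) @ \oo --> (0 : R) ->
  (fun k => nrm V (fun x => u k x - f x)) @ \oo --> (0 : R).
Proof.
move=> uL fL uf; rewrite -[X in _ --> X]sqrtr0.
by apply: continuous_cvg; first exact: sqrt_continuous.
Qed.

(** The approximants [u k] may violate the constraints, but [<u_k, g_i> = <u_k - f, g_i>] tends to
    0, so the stable form of the bound passes to the limit. *)
Lemma rayleigh_bound_limit n (g : 'I_n -> R -> R) a (u : nat -> R -> R) f q : 0 <= a ->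
  (forall i, L2mu V (g i)) -> rayleigh_bound g a ->
  (forall k, Cc_inf (u k)) -> L2mu V f -> (forall i, ipmu V f (g i) = 0) ->
  (fun k => nrm V (fun x => u k x - f x)) @ \oo --> (0 : R) ->
  (fun k => nrm V (derive1 (u k))) @ \oo --> q ->
  Num.sqrt a * nrm V f <= q.
Proof.
move=> a0 gL ga hu fL fg uf uq.
have [C C0 hC] := rayleigh_bound_stable a0 gL ga.
have uL k := L2mu_Cc_inf cV hZ (hu k).
have S0 : (fun k => \sum_(i < n) `|ipmu V (u k) (g i)|) @ \oo --> (0 : R).
  apply: (@cvg_nrm_bound _ (fun k => nrm V (fun x => u k x - f x) * \sum_(i < n) nrm V (g i))).
    by rewrite -[X in _ --> X](mul0r (\sum_(i < n) nrm V (g i))); apply: cvgMr_tmp.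
  move=> k; rewrite ger0_norm ?sumr_ge0// mulr_sumr; apply: ler_sum => i _.
  rewrite -[ipmu _ _ _]subr0 -(fg i) -(ipmuBl cV (uL k) fL (gL i)).
  by apply: cauchy_schwarz => //; exact: L2muB.
have l1 : (fun k => Num.sqrt a * nrm V (u k)) @ \oo --> Num.sqrt a * nrm V f.
  by apply: cvgMl_tmp; exact: cvg_nrm.
have l2 : (fun k => nrm V (derive1 (u k)) + C * \sum_(i < n) `|ipmu V (u k) (g i)|)
    @ \oo --> q.
  rewrite -[X in _ --> X]addr0 -[X in _ --> _ + X](mulr0 C).
  by apply: cvgD; [exact: uq|apply: cvgMl_tmp; exact: S0].
by apply: (ler_cvg_to l1 l2); apply: nearW => k; exact: hC.
Qed.

(** From the core to the domain: along the approximating sequence [|u_k'|^2 = - <u_k, L u_k>]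
    converges to [- <f, L f>]. *)
Lemma rayleigh_bound_Lgraph n (g : 'I_n -> R -> R) a f Lf : 0 <= a ->
  (forall i, L2mu V (g i)) -> rayleigh_bound g a -> Lgraph V f Lf ->
  (forall i, ipmu V f (g i) = 0) -> a * ipmu V f f <= - ipmu V f Lf.
Proof.
move=> a0 gL ga [fL [LfL [u [hu [uf uLf]]]]] fg.
have uL k := L2mu_Cc_inf cV hZ (hu k).
have LuL k := L2mu_Cc_inf cV hZ (Cc_inf_Lop sV (hu k)).
have uf' := L2mu_nrm0_ipmu uL fL uf.
have uLf' := L2mu_nrm0_ipmu LuL LfL uLf.
have qc : (fun k => ipmu V (derive1 (u k)) (derive1 (u k))) @ \oo --> - ipmu V f Lf.
  rewrite (_ : (fun k => _) = fun k => - ipmu V (u k) (Lop V (u k))).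
    by apply: cvgN; exact: cvg_ipmu uL LuL fL LfL uf' uLf'.
  by apply/funext => k; rewrite (ipmu_Lop sV hZ (hu k)).
have q0 : 0 <= - ipmu V f Lf.
  by apply: (ler_cvg_to (cvg_cst (0 : R)) qc); apply: nearW => k; exact: ipmu_ge0.
have nc : (fun k => nrm V (derive1 (u k))) @ \oo --> Num.sqrt (- ipmu V f Lf).
  by apply: continuous_cvg; first exact: sqrt_continuous.
have := rayleigh_bound_limit a0 gL ga hu fL fg uf' nc.
rewrite -(@ler_pXn2r _ 2)// ?nnegrE ?mulr_ge0 ?sqrtr_ge0//.
by rewrite exprMn sqr_nrm !sqr_sqrtr.
Qed.

(* [F] is reached from test functions by cutting off. *)
Lemma rayleigh_bound_extend n (g : 'I_n -> R -> R) a F B : 0 <= a ->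
  (forall i, L2mu V (g i)) -> rayleigh_bound g a -> smooth F ->
  (forall x, `|F x| <= B) -> compact_supp (derive1 F) ->
  (forall i, ipmu V F (g i) = 0) ->
  a * ipmu V F F <= ipmu V (derive1 F) (derive1 F).
Proof.
move=> a0 gL ga sF FB cF' Fg; have sF' := smooth_derive1 sF.
have B0 : 0 <= B by apply: le_trans (FB 0).
have [B' F'B] := continuous_compact_supp_bounded (smooth_continuous sF') cF'.
have B'0 : 0 <= B' by apply: le_trans (F'B 0).
have [chi [C [hchi chiC chi'C chi1]]] := smooth_cutoffs R.
have C0 : 0 <= C by apply: le_trans (chiC 0%N 0).
have FL : L2mu V F.
  by apply: (L2mu_bounded cV hZ _ FB); apply: continuous_measurable_fun;
    exact: (smooth_continuous sF).
pose u k x := F x * chi k x.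
have hu k : Cc_inf (u k) by exact: Cc_infM sF (hchi k).
have large x : \forall k \near \oo, `|x| < k%:R.
  exists (Num.truncn `|x|).+1 => // k /= hk.
  by rewrite (lt_le_trans (truncnS_gt _))// ler_nat.
have uF : (fun k => nrm V (fun x => u k x - F x)) @ \oo --> (0 : R).
  apply: (nrm_dominated_cvg cV _ (L2mu_cst cV hZ (B * C + B))).
  - move=> k; apply: measurable_funB; last exact: (L2mu_measurable FL).
    exact: L2mu_measurable (L2mu_Cc_inf cV hZ (hu k)).
  - move=> k x; rewrite (le_trans (ler_normB _ _))// lerD// normrM.
    exact: ler_pM.
  - move=> x; apply: cvg_near_cst; apply: filterS (large x) => k xk.
    by rewrite /u chi1// mulr1 subrr.
have uF' : (fun k => nrm V (fun x => derive1 (u k) x - derive1 F x)) @ \oo --> (0 : R).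
  have E k : derive1 (u k) = fun x => derive1 F x * chi k x + F x * derive1 (chi k) x.
    exact: (derive1M sF (proj1 (hchi k))).
  apply: (nrm_dominated_cvg cV _ (L2mu_cst cV hZ (B' * C + B * C + B'))).
  - move=> k; apply: measurable_funB.
      exact: L2mu_measurable (L2mu_Cc_inf cV hZ (Cc_inf_derive1 (hu k))).
    by apply: continuous_measurable_fun; exact: (smooth_continuous sF').
  - move=> k x; rewrite E (le_trans (ler_normB _ _))// lerD//.
    by rewrite (le_trans (ler_normD _ _))// !normrM lerD//; apply: ler_pM.
  - move=> x; apply: cvg_near_cst; apply: filterS (large x) => k xk.
    (* Once [|x| < k] the cutoff is constant near [x]. *)
    have d0 : derive1 (chi k) x = 0.
      transitivity (derive1 (fun=> 1 : R) x); last by rewrite (derive1_eq (is_derive_cst1 1)).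
      rewrite !derive1E; apply: near_eq_derive.
      have : \forall y \near x, `|y| < k%:R.
        by apply: (cvgr_lt _ (@norm_continuous _ R x)).
      by apply: filterS => y; exact: chi1.
    by rewrite E chi1// mulr1 d0 mulr0 addr0 subrr.
have nF' := cvg_nrm (fun k => L2mu_Cc_inf cV hZ (Cc_inf_derive1 (hu k)))
  (L2mu_Cc cV hZ (smooth_continuous sF') cF') uF'.
by rewrite -nrm_le_sqr//; exact: rayleigh_bound_limit a0 gL ga hu FL Fg uF nF'.
Qed.

Let perturbation_arith (N N' e C m sa sb : R) : 0 <= N -> 0 <= e ->
  e * (C * m + 1) = sa - sb -> sa * N <= N' + C * (m * (N * e)) -> sb * N <= N'.
Proof.
move=> N0 e0 E; have : N * (e * (C * m + 1)) = N * (sa - sb) by rewrite E.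
have := mulr_ge0 N0 e0; lra.
Qed.

Lemma rayleigh_bound_perturb n (g : 'I_n -> R -> R) a b : 0 <= b -> b < a ->
  (forall i, L2mu V (g i)) -> rayleigh_bound g a ->
  exists h : 'I_n -> R -> R, (forall i, continuous (h i) /\ compact_supp (h i)) /\
    rayleigh_bound h b.
Proof.
move=> b0 ba gL ga; have a0 : 0 < a by exact: le_lt_trans ba.
have [C C0 hC] := rayleigh_bound_stable (ltW a0) gL ga.
have ab : 0 < Num.sqrt a - Num.sqrt b by rewrite subr_gt0 ltr_sqrt.
(* A function orthogonal to every [h i] satisfies [|<f, g_i>| <= d |f|], so the loss is [C n d |f|],
   less than the gap between the square roots times [|f|] for nonzero [|f|]; the added 1 keeps the
   denominator positive. *)
pose d := (Num.sqrt a - Num.sqrt b) / (C * n%:R + 1).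
have Cn : 0 < C * n%:R + 1 by rewrite ltr_wpDl// mulr_ge0.
have d0 : 0 < d by exact: divr_gt0.
have /choice[h hh] : forall i, exists h,
    [/\ continuous h, compact_supp h & nrm V (fun x => g i x - h x) < d].
  by move=> i; exact: (dense_Cc cV hZ (gL i) d0).
exists h; split; first by move=> i; case: (hh i).
move=> f hf fh; rewrite -nrm_le_sqr//.
have fL := L2mu_Cc_inf cV hZ hf.
have S : \sum_(i < n) `|ipmu V f (g i)| <= n%:R * (nrm V f * d).
  rewrite -[n in n%:R]card_ord -sum1_card natr_sum mulr_suml; apply: ler_sum => i _.
  have [ch sh hd] := hh i; have hL := L2mu_Cc cV hZ ch sh.
  rewrite mul1r -[ipmu _ _ _]subr0 -(fh i) -(ipmuBr fL (gL i) hL).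
  rewrite (le_trans (cauchy_schwarz cV fL (L2muB cV (gL i) hL)))//.
  by rewrite ler_wpM2l ?nrm_ge0// ltW.
have := le_trans (hC _ hf) (lerD (lexx _) (ler_wpM2l C0 S)).
have E : d * (C * n%:R + 1) = Num.sqrt a - Num.sqrt b by rewrite /d divfK// gt_eqF.
exact: perturbation_arith (nrm_ge0 V f) (ltW d0) E.
Qed.

End ConstrainedRayleigh.

(** * Variational description of the eigenvalues *)

Section SpectralGaps.
Variables (R : realType) (V : R -> R).
Hypothesis sV : smooth V.
Hypothesis hZ : (\int[@lebesgue_measure R]_x (wgt V x)%:E < +oo)%E.
Implicit Types (f g h u w F : R -> R) (x c a b : R).
Notation leb := (@lebesgue_measure R).
Let cV : continuous V := smooth_continuous sV.
Let CL f : Cc_inf f -> L2mu V f := @L2mu_Cc_inf R V cV hZ f.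

(** Its supremum will be the max-min value, now as a real number; the sign condition suits the
    square roots of the stable bound, and 0 always belongs to the set. *)
Definition rayleigh_bounds n : set R := [set a | 0 <= a /\
  exists g : 'I_n -> R -> R, (forall i, L2mu V (g i)) /\ rayleigh_bound V g a].

Lemma rayleigh_bounds0 n : rayleigh_bounds n 0.
Proof.
split=> //; exists (fun _ _ => 0); split=> [i|f _ _]; first exact: L2mu_cst.
by rewrite mul0r ipmu_ge0.
Qed.

(** Supported in [[2k, 2k+1]]; the unit gaps between these intervals make the derivatives disjoint
    as well. *)
Definition translate (k : nat) x : R := bump_fun (1 * x + - (2 * k%:R)).

Lemma Cc_inf_translate k : Cc_inf (translate k).
Proof.
split; first exact: smooth_affine (@smooth_bump_fun R).
exists (2 * k%:R + 1) => x xk; apply: bump_fun_supp; rewrite mul1r.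
have := ler_distD (2 * k%:R) x 0; rewrite !subr0 (ger0_norm (x := 2 * k%:R)) ?mulr_ge0//.
lra.
Qed.

Lemma translate_disjoint k l x : k != l -> translate k x * translate l x = 0.
Proof.
move=> kl; rewrite /translate !mul1r.
have [xk|xk] := leP (x + - (2 * k%:R)) 0; first by rewrite bump_fun_left// mul0r.
have [kx|kx] := leP 1 (x + - (2 * k%:R)); first by rewrite bump_fun_right// mul0r.
have [lt|lt|E] := ltngtP k l; last by rewrite E eqxx in kl.
- have : k.+1%:R <= l%:R :> R by rewrite ler_nat.
  by rewrite -natr1 => ?; rewrite [X in _ * X]bump_fun_left ?mulr0//; lra.
- have : l.+1%:R <= k%:R :> R by rewrite ler_nat.
  by rewrite -natr1 => ?; rewrite [X in _ * X]bump_fun_right ?mulr0//; lra.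
Qed.

Lemma derive1_translate_neq0 k x : derive1 (translate k) x != 0 ->
  2 * k%:R <= x <= 2 * k%:R + 1.
Proof.
move=> h; apply/negPn/negP; rewrite negb_and -!ltNge => out; move/eqP: h; apply.
apply: derive1_near0; case/orP: out => xk.
- have : \forall y \near x, y < 2 * k%:R by exact: lt_nbhsl.
  by apply: filterS => y yk; apply: bump_fun_left; lra.
- have : \forall y \near x, 2 * k%:R + 1 < y by have /cvgr_gt := @cvg_id _ (nbhs x); apply.
  by apply: filterS => y yk; apply: bump_fun_right; lra.
Qed.

Lemma derive1_translate_disjoint k l x : k != l ->
  derive1 (translate k) x * derive1 (translate l) x = 0.
Proof.
move=> kl; have [->|/derive1_translate_neq0 hk] := eqVneq (derive1 (translate k) x) 0.
  by rewrite mul0r.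
have [->|/derive1_translate_neq0 hl] := eqVneq (derive1 (translate l) x) 0.
  by rewrite mulr0.
exfalso; move: hk hl => /andP[h1 h2] /andP[h3 h4].
have [lt|lt|E] := ltngtP k l; last by rewrite E eqxx in kl.
- have : k.+1%:R <= l%:R :> R by rewrite ler_nat.
  by rewrite -natr1; lra.
- have : l.+1%:R <= k%:R :> R by rewrite ler_nat.
  by rewrite -natr1; lra.
Qed.

Lemma ipmu_eq0 f g : (forall x, f x * g x = 0) -> ipmu V f g = 0.
Proof.
move=> fg; rewrite ipmuE (mean_eq _ (g := fun=> 0 * 0)).
  by rewrite -ipmuE ipmu0l.
by move=> x; rewrite fg mul0r.
Qed.

Lemma ipmu_orthogonal_combination n (c : 'I_n -> R) (phi : 'I_n -> R -> R) :
  (forall i, L2mu V (phi i)) -> (forall i j, i != j -> ipmu V (phi i) (phi j) = 0) ->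
  ipmu V (combination c phi) (combination c phi) =
  \sum_(i < n) c i ^+ 2 * ipmu V (phi i) (phi i).
Proof.
move=> hp op; have hc := L2mu_combination sV hZ c hp.
rewrite (ipmu_combination sV hZ c hp hc); apply: eq_bigr => i _.
rewrite ipmuC (ipmu_combination sV hZ c hp (hp i)) (bigD1 i)//= big1 ?addr0.
  by rewrite expr2 mulrA.
by move=> j ji; rewrite op ?mulr0.
Qed.

Lemma exists_row_kernel n (A : 'M[R]_(n.+1, n)) : exists2 v : 'rV[R]_n.+1, v != 0 & v *m A = 0.
Proof.
have /rowV0Pn[v /sub_kermxP vA v0] : kermx A != 0.
  by rewrite kermx_eq0 /row_free neq_ltn ltnS rank_leq_col.
by exists v.
Qed.

(* Among [n + 1] bumps with disjoint supports, some nonzero combination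
   satisfies the [n] constraints. *)
Lemma rayleigh_bounds_ubound n : exists K, forall a, rayleigh_bounds n a -> a <= K.
Proof.
pose phi (i : 'I_n.+1) := translate i.
have hphi i : Cc_inf (phi i) := Cc_inf_translate i.
have phi0 i : 0 < ipmu V (phi i) (phi i).
  apply: (ipmu_gt0 sV hZ (smooth_continuous (proj1 (hphi i))) (proj2 (hphi i))
    (x := 2 * i%:R + 2^-1)).
  by rewrite gt_eqF// /phi /translate bump_fun_gt0//; lra.
pose q i := ipmu V (derive1 (phi i)) (derive1 (phi i)).
(* By disjointness the Rayleigh quotient of a combination is a weighted average of those of the
   bumps, hence at most their sum. *)
exists (\sum_i q i / ipmu V (phi i) (phi i)) => a [a0 [g [gL ga]]].
have [v v0 vA] := exists_row_kernel (\matrix_(i, j) ipmu V (phi i) (g j)).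
pose c i := v ord0 i; pose f := combination c phi.
have hf : Cc_inf f := Cc_inf_combination c hphi.
have fg j : ipmu V f (g j) = 0.
  rewrite (ipmu_combination sV hZ c (fun i => CL (hphi i)) (gL j)).
  have E : (v *m \matrix_(i, j) ipmu V (phi i) (g j)) ord0 j = 0 by rewrite vA mxE.
  by rewrite -[RHS]E mxE; apply: eq_bigr => i _; rewrite mxE.
have dj (i j : 'I_n.+1) : i != j -> (i : nat) != j by [].
have := ga f hf fg; rewrite (derive1_combination c hphi).
rewrite (ipmu_orthogonal_combination c (fun i => CL (hphi i))); last first.
  by move=> i j ij; apply: ipmu_eq0 => x; exact: translate_disjoint (dj _ _ ij).
rewrite (ipmu_orthogonal_combination c (fun i => CL (Cc_inf_derive1 (hphi i)))); last first.
  by move=> i j ij; apply: ipmu_eq0 => x; exact: derive1_translate_disjoint (dj _ _ ij).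
set S := \sum_(i < n.+1) _.
have S0 : 0 < S.
  have [i vi] : exists i, v ord0 i != 0.
    apply: contrapT => h; move/eqP: v0; apply; apply/rowP => i; rewrite mxE.
    by apply/eqP; apply: contrapT => /negP vi; apply: h; exists i.
  rewrite /S (bigD1 i)//=; apply: ltr_pwDl.
    by apply: mulr_gt0 => //; rewrite exprn_even_gt0.
  by apply: sumr_ge0 => j _; rewrite mulr_ge0 ?sqr_ge0 ?ipmu_ge0.
move=> h; rewrite -(ler_pM2r S0) (le_trans h)// mulr_sumr; apply: ler_sum => i _.
rewrite [leRHS]mulrCA ler_wpM2l ?sqr_ge0// -/(q i) -ler_pdivrMr//.
rewrite (bigD1 i)//= lerDl; apply: sumr_ge0 => j _.
by rewrite divr_ge0 ?ipmu_ge0.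
Qed.

Lemma has_sup_rayleigh_bounds n : has_sup (rayleigh_bounds n).
Proof.
split; first by exists 0; exact: rayleigh_bounds0.
by have [K hK] := rayleigh_bounds_ubound n; exists K => a /hK.
Qed.

Lemma ipmu11 : ipmu V (fun=> 1) (fun=> 1) = 1.
Proof.
rewrite /ipmu (_ : fine _ = Zc V) ?divff ?gt_eqF ?Zc_gt0//.
by congr fine; apply: eq_integral => x _; rewrite !mul1r.
Qed.

Lemma derive1_cst_fun c : derive1 (fun=> c : R) = fun=> 0.
Proof. exact: derive1_eq (is_derive_cst1 c). Qed.

(** The constant 1 has zero energy; it is not a test function, whence the extension by cutoffs. This
    gives the value 0 without constraints, and shows that a positive bound needs a constraint that
    sees the constants. *)
Lemma rayleigh_bound_cst n (g : 'I_n -> R -> R) a : 0 <= a ->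
  (forall i, L2mu V (g i)) -> rayleigh_bound V g a ->
  (forall i, ipmu V (fun=> 1) (g i) = 0) -> a <= 0.
Proof.
move=> a0 gL ga g1.
have := rayleigh_bound_extend sV hZ (F := fun=> 1) (B := 1) a0 gL ga.
rewrite derive1_cst_fun ipmu0l ipmu11 mulr1; apply => //.
- exact: smooth_cst.
- by move=> _; rewrite normr1.
- by exists 0.
Qed.

Lemma Lgraph_Cc_inf f : Cc_inf f -> Lgraph V f (Lop V f).
Proof.
move=> hf; split; first exact: CL.
split; first by apply: CL; exact: Cc_inf_Lop.
exists (fun=> f); split => //.
have E h : ipmu V (h \- h) (h \- h) = 0 by apply: ipmu_eq0 => x /=; rewrite subrr mul0r.
by rewrite !E; split; exact: cvg_cst.
Qed.

(** Test functions lie in the domain of [L], which gives one direction; the other is the passage to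
    the closure. *)
Lemma le_ereal_inf_rayleigh n (g : 'I_n -> R -> R) a : 0 <= a ->
  (forall i, L2mu V (g i)) ->
  (a%:E <= ereal_inf (rayleigh_set V g))%E <-> rayleigh_bound V g a.
Proof.
move=> a0 gL; split=> [ag f hf fg|ga].
  have [f0|] := ltP 0 (ipmu V f f); last first.
    move=> f0; have -> : ipmu V f f = 0 by apply/eqP; rewrite eq_le f0 ipmu_ge0.
    by rewrite mulr0 ipmu_ge0.
  rewrite -(ipmu_Lop sV hZ hf) -ler_pdivlMr// -lee_fin (le_trans ag)//.
  by apply: ereal_inf_lbound; exists f, (Lop V f); split => //; exact: Lgraph_Cc_inf.
apply: le_ereal_inf_tmp => _ [f [Lf [fLf f0 fg ->]]].
by rewrite lee_fin ler_pdivlMr//; exact: (rayleigh_bound_Lgraph sV hZ a0 gL ga fLf).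
Qed.

(** For [n = 0] the value 0 is set by definition, and the supremum agrees by testing on constants.
    Otherwise both sides have the same nonnegative lower bounds, and disjoint bumps make the
    supremum finite. *)
Lemma lambdaE n : lambda V n = (sup (rayleigh_bounds n))%:E.
Proof.
have [S0 Sb] := has_sup_rayleigh_bounds n; have S00 := rayleigh_bounds0 n.
have sup_ge0 : 0 <= sup (rayleigh_bounds n) by exact: ub_le_sup.
case: n S0 Sb S00 sup_ge0 => [|n] S0 Sb S00 sup_ge0.
  congr _%:E; apply/eqP; rewrite eq_le sup_ge0/=.
  apply: ge_sup => // a [a0 [g [gL ga]]].
  by apply: rayleigh_bound_cst ga _ => // -[].
apply/eqP; rewrite eq_le; apply/andP; split.
  apply: ge_ereal_sup => _ [g /= gL <-]; rewrite leNgt; apply/negP => lt.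
  (* The infimum may a priori be infinite, so a real number above the supremum is taken first. *)
  have [a sa ag] : exists2 a, sup (rayleigh_bounds n.+1) < a &
      (a%:E <= ereal_inf (rayleigh_set V g))%E.
    move: lt; case: (ereal_inf _) => [r|_|//].
      by rewrite lte_fin => lt; exists r.
    by exists (sup (rayleigh_bounds n.+1) + 1); rewrite ?ltrDl ?leey.
  have a0 : 0 <= a by rewrite ltW// (le_lt_trans sup_ge0).
  have : a <= sup (rayleigh_bounds n.+1).
    apply: ub_le_sup => //; split => //; exists g; split => //.
    exact/(le_ereal_inf_rayleigh a0 gL).
  by rewrite leNgt sa.
have le_l a : rayleigh_bounds n.+1 a -> (a%:E <= lambda V n.+1)%E.
  move=> [a0 [g [gL ga]]]; apply: le_trans (ereal_sup_ubound _); last by exists g.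
  exact/le_ereal_inf_rayleigh.
move: le_l; case: (lambda V n.+1) => [r|_|/(_ _ S00)//]; last exact: leey.
by move=> le_l; rewrite lee_fin; apply: ge_sup => // a /le_l; rewrite lee_fin.
Qed.

End SpectralGaps.

(** * Comparison of consecutive eigenvalues *)

Section Intertwining.
Variables (R : realType) (V : R -> R).
Hypothesis sV : smooth V.
Hypothesis hZ : (\int[@lebesgue_measure R]_x (wgt V x)%:E < +oo)%E.
Implicit Types (f g h u w F : R -> R) (x c a b : R).
Notation leb := (@lebesgue_measure R).
Let cV : continuous V := smooth_continuous sV.
Let CL f : Cc_inf f -> L2mu V f := @L2mu_Cc_inf R V cV hZ f.

(** Eliminates [W2]: [a N2^2 <= Q2 (a W2) <= Q2 N2], then division by [N2]. It trades a bound
    between a function and its image under the derivative or its adjoint for the reverse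
    composition. *)
Let interpolation (a N2 Q2 W2 : R) : 0 <= a -> 0 <= N2 -> 0 <= Q2 ->
  N2 ^+ 2 <= Q2 * W2 -> a * W2 <= N2 -> a * N2 <= Q2.
Proof.
move=> a0 N0 Q0 h1 h2.
move: N0; rewrite le_eqVlt => /predU1P[<-|N0]; first by rewrite mulr0.
rewrite -(ler_pM2r N0).
have := ler_wpM2l a0 h1; have := ler_wpM2l Q0 h2.
by move=> h3 h4; apply: le_trans h3; rewrite mulrCA -mulrA -expr2.
Qed.

Lemma cauchy_schwarz_sqr f g : L2mu V f -> L2mu V g ->
  ipmu V f g ^+ 2 <= ipmu V f f * ipmu V g g.
Proof.
move=> fL gL; rewrite -!sqr_nrm -exprMn -[ipmu _ _ _ ^+ 2]real_normK ?num_real//.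
by rewrite ler_pXn2r ?nnegrE ?mulr_ge0 ?nrm_ge0 ?normr_ge0//; exact: cauchy_schwarz.
Qed.

Lemma mu_integrable_potential w : Cc_inf w ->
  mu_integrable V (fun x => derive1 (derive1 V) x * (w x * w x)).
Proof.
move=> hw; apply: (mu_integrable_Cc_inf sV hZ).
exact: Cc_infM (smooth_derive1 (smooth_derive1 sV)) (Cc_infM (proj1 hw) hw).
Qed.

Lemma ipmu_adj_adj_ge k w : (forall x, k <= derive1 (derive1 V) x) -> Cc_inf w ->
  ipmu V (derive1 w) (derive1 w) + k * ipmu V w w <= ipmu V (adj V w) (adj V w).
Proof.
move=> kV hw; rewrite (ipmu_adj_adj sV hZ hw) lerD2l ipmuE.
have Iw := mu_integrable_Cc_inf sV hZ (Cc_infM (proj1 hw) hw).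
rewrite -(meanZ k Iw).
apply: le_mean; [exact: mu_integrableZ|exact: mu_integrable_potential|].
by move=> x; rewrite ler_wpM2r// -expr2 sqr_ge0.
Qed.

Lemma ipmu_adj_adj_le k w : (forall x, derive1 (derive1 V) x <= k) -> Cc_inf w ->
  ipmu V (adj V w) (adj V w) <= ipmu V (derive1 w) (derive1 w) + k * ipmu V w w.
Proof.
move=> kV hw; rewrite (ipmu_adj_adj sV hZ hw) lerD2l ipmuE.
have Iw := mu_integrable_Cc_inf sV hZ (Cc_infM (proj1 hw) hw).
rewrite -(meanZ k Iw).
apply: le_mean; [exact: mu_integrable_potential|exact: mu_integrableZ|].
by move=> x; rewrite ler_wpM2r// -expr2 sqr_ge0.
Qed.

Lemma mean_ipmu1 f : ipmu V f (fun=> 1) = mean V f.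
Proof. by rewrite ipmuE; apply: mean_eq => x; rewrite mulr1. Qed.

Lemma is_derive_adj_inv_continuous u : continuous u -> compact_supp u ->
  continuous (fun x => - u x + derive1 V x * adj_inv V u x).
Proof.
move=> cu su x; apply: cvgD; first by apply: cvgN; exact: cu.
apply: cvgM; first exact: (smooth_continuous (smooth_derive1 sV)).
exact: (is_derive_continuous (fun x => is_derive_adj_inv sV x cu su)).
Qed.

(** Transfers constraints: orthogonality to a mean-zero [u] becomes orthogonality of the derivative
    to [adj_inv V u]. *)
Lemma ipmu_adj_inv F dF u : (forall x, is_derive x (1 : R) F (dF x)) -> continuous dF ->
  continuous u -> compact_supp u -> mean V u = 0 ->
  ipmu V F u = ipmu V dF (adj_inv V u).
Proof.
move=> hF cdF cu su u0.
rewrite -(ipmu_adjoint sV hZ hF cdF (fun x => is_derive_adj_inv sV x cu su)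
  (is_derive_adj_inv_continuous cu su) (compact_supp_adj_inv sV hZ su u0)).
by rewrite !ipmuE; apply: mean_eq => x; ring.
Qed.

Lemma adj_adj_inv u : Cc_inf u -> adj V (adj_inv V u) = u.
Proof.
move=> [su cu]; apply/funext => x; rewrite /adj.
rewrite (derive1_eq (fun x => is_derive_adj_inv sV x (smooth_continuous su) cu)).
by ring.
Qed.

(** With [f = adj V w], [|f|^2 >= |w'|^2 + k |w|^2 >= (b + k) |w|^2], and Cauchy-Schwarz turns this
    into [|f'|^2 >= (b + k) |f|^2]. *)
Lemma rayleigh_bounds_shift_up n (h : 'I_n -> R -> R) b k : 0 <= b -> 0 <= k ->
  (forall x, k <= derive1 (derive1 V) x) ->
  (forall i, continuous (h i) /\ compact_supp (h i)) -> rayleigh_bound V h b ->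
  rayleigh_bounds V n.+1 (b + k).
Proof.
move=> b0 k0 kV hh hb; split; first exact: addr_ge0.
(* The extra constraint 1 makes [f] mean zero, hence in the range of the adjoint; the primitives
   make [w] orthogonal to the [h j]. *)
exists (fun i => if unlift ord0 i is Some j then primitive (h j) else fun=> 1).
have hP j x := is_derive_primitive x (proj1 (hh j)) (proj2 (hh j)).
split.
  move=> i; case: unliftP => [j _|_]; last exact: L2mu_cst.
  have [B PB] := primitive_bounded (proj1 (hh j)) (proj2 (hh j)).
  apply: (L2mu_bounded cV hZ _ PB); apply: continuous_measurable_fun.
  exact: (is_derive_continuous (hP j)).
move=> f hf fG.
have f0 : mean V f = 0 by have := fG ord0; rewrite unlift_none mean_ipmu1.
have fP j : ipmu V f (primitive (h j)) = 0 by have := fG (lift ord0 j); rewrite liftK.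
pose w := adj_inv V f; have hw : Cc_inf w := Cc_inf_adj_inv sV hZ hf f0.
have wh i : ipmu V w (h i) = 0.
  rewrite ipmuC -(ipmu_adj_inv (hP i) (proj1 (hh i)) (smooth_continuous (proj1 hf))
    (proj2 hf) f0).
  by rewrite ipmuC; exact: fP.
have q1 := hb _ hw wh; have q2 := ipmu_adj_adj_ge kV hw.
have fw : ipmu V f f = ipmu V (derive1 f) w.
  by rewrite -{2}(adj_adj_inv hf) (ipmu_adj sV hZ (proj1 hf) hw).
rewrite (adj_adj_inv hf) in q2.
apply: (@interpolation _ _ _ (ipmu V w w)); rewrite ?addr_ge0 ?ipmu_ge0//.
  by rewrite {1}fw; exact: cauchy_schwarz_sqr (CL (Cc_inf_derive1 hf)) (CL hw).
by rewrite mulrDl; lra.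
Qed.

(** For a suitable primitive [F] of [w], [b |F|^2 <= |w|^2]; Cauchy-Schwarz gives [b |w|^2 <= |adj V
    w|^2 <= |w'|^2 + k |w|^2]. *)
Lemma rayleigh_bounds_shift_down n (g : 'I_n.+1 -> R -> R) b k : 0 < b -> k <= b ->
  (forall x, derive1 (derive1 V) x <= k) ->
  (forall i, continuous (g i) /\ compact_supp (g i)) -> rayleigh_bound V g b ->
  rayleigh_bounds V n (b - k).
Proof.
move=> b0 kb Vk hg gb; split; first by rewrite subr_ge0.
have gL i : L2mu V (g i) by apply: L2mu_Cc => //; case: (hg i).
have [i0 gi0] : exists i, ipmu V (fun=> 1) (g i) != 0.
  apply: contrapT => H; have := rayleigh_bound_cst sV hZ (ltW b0) gL gb.
  rewrite leNgt b0 => /(_ _)/negP; apply => // i.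
  by apply/eqP; apply: contrapT => /negP gi; apply: H; exists i.
(* Elimination with pivot [g i0]: the other constraints become mean zero, so [adj_inv] applies to
   them. *)
pose r j := ipmu V (fun=> 1) (g (lift i0 j)) / ipmu V (fun=> 1) (g i0).
pose gh j x := g (lift i0 j) x - r j * g i0 x.
have cgh j : continuous (gh j).
  move=> x; apply: cvgB; first exact: (proj1 (hg _)).
  by apply: cvgMl_tmp; exact: (proj1 (hg _)).
have sgh j : compact_supp (gh j).
  apply: compact_suppD; first exact: (proj2 (hg _)).
  by apply: compact_suppN; apply: compact_suppMr; exact: (proj2 (hg _)).
have ip_gh F j : L2mu V F ->
    ipmu V F (gh j) = ipmu V F (g (lift i0 j)) - r j * ipmu V F (g i0).
  move=> FL; rewrite (ipmuBr sV FL (gL _) (L2muZ cV _ (gL _))); congr (_ - _).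
  by rewrite ipmuC (ipmuZl cV _ (gL _) FL) ipmuC.
have L1 := L2mu_cst cV hZ 1.
have gh0 j : mean V (gh j) = 0.
  by rewrite -mean_ipmu1 ipmuC ip_gh// /r divfK// subrr.
exists (fun j => adj_inv V (gh j)); split.
  move=> j; apply: L2mu_Cc => //; last exact: compact_supp_adj_inv.
  exact: (is_derive_continuous (fun x => is_derive_adj_inv sV x (cgh j) (sgh j))).
move=> w hw wk; have [sw cw] := hw; have cntw := smooth_continuous sw.
pose P := primitive w.
have sP : smooth P := smooth_primitive sw cw.
have [B PB] := primitive_bounded cntw cw.
have mP : measurable_fun setT P.
  by apply: continuous_measurable_fun; exact: (smooth_continuous sP).
have PL : L2mu V P := L2mu_bounded cV hZ mP PB.
(* The free constant of integration is spent on the pivot constraint. *)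
pose c := - (ipmu V P (g i0) / ipmu V (fun=> 1) (g i0)).
pose F x := P x + c.
have sF : smooth F := smoothD sP (@smooth_cst _ c).
have FL : L2mu V F := L2muD cV PL (L2mu_cst cV hZ c).
have hF x : is_derive x (1 : R) F (w x).
  by have := is_derive_add (is_derive_primitive x cntw cw) (is_derive_cst1 c x); rewrite addr0.
have dF : derive1 F = w := derive1_eq hF.
have Fg0 : ipmu V F (g i0) = 0.
  rewrite (ipmuDl cV PL (L2mu_cst cV hZ c) (gL _)).
  have -> : (fun=> c) = (fun x : R => c * 1) by apply/funext => x; rewrite mulr1.
  by rewrite (ipmuZl cV c L1 (gL _)) /c mulNr divfK// subrr.
have Fg i : ipmu V F (g i) = 0.
  case: (unliftP i0 i) => [j ->|->] //.
  have := ip_gh F j FL; rewrite Fg0 mulr0 subr0 => <-.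
  by rewrite (ipmu_adj_inv hF cntw (cgh j) (sgh j) (gh0 j)).
have FB x : `|F x| <= B + `|c| by rewrite (le_trans (ler_normD _ _))// lerD.
have := rayleigh_bound_extend sV hZ (ltW b0) gL gb sF FB.
rewrite dF => /(_ cw Fg) q1; have q2 := ipmu_adj_adj_le Vk hw.
have wF : ipmu V w w = ipmu V (adj V w) F.
  by rewrite [RHS]ipmuC (ipmu_adj sV hZ sF hw) dF.
rewrite mulrBl lerBlDr (le_trans _ q2)//.
apply: (@interpolation _ _ _ (ipmu V F F)); rewrite ?(ltW b0) ?ipmu_ge0//.
by rewrite {1}wF; exact: cauchy_schwarz_sqr (CL (Cc_inf_adj sV hw)) FL.
Qed.

Lemma sup_rayleigh_bounds_ge n k : 0 <= k -> (forall x, k <= derive1 (derive1 V) x) ->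
  sup (rayleigh_bounds V n) + k <= sup (rayleigh_bounds V n.+1).
Proof.
move=> k0 kV; have [S0 _] := has_sup_rayleigh_bounds sV hZ n.
have [_ Sb] := has_sup_rayleigh_bounds sV hZ n.+1.
rewrite -lerBrDr; apply: ge_sup => // a [a0 [g [gL ga]]].
apply/ler_addgt0Pr => e e0; rewrite -lerBlDr lerBrDr.
(* Too small a bound cannot be perturbed within nonnegative numbers; zero constraints and [b = 0]
   already give [k]. *)
have [ae|ea] := leP (a - e) 0.
  have Sk : rayleigh_bounds V n.+1 (0 + k).
    apply: (@rayleigh_bounds_shift_up n (fun _ _ => 0)) => //.
      by move=> i; split; [move=> x; exact: cvg_cst|exists 0].
    by move=> f _ _; rewrite mul0r ipmu_ge0.
  by rewrite (le_trans _ (ub_le_sup Sb Sk))// lerD2r.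
have [|h [hh hb]] := rayleigh_bound_perturb sV hZ (ltW ea) _ gL ga.
  by rewrite gtrBl.
by apply: ub_le_sup => //; exact: rayleigh_bounds_shift_up (ltW ea) k0 kV hh hb.
Qed.

Lemma sup_rayleigh_bounds_le n k : 0 <= k -> (forall x, derive1 (derive1 V) x <= k) ->
  sup (rayleigh_bounds V n.+1) <= sup (rayleigh_bounds V n) + k.
Proof.
move=> k0 Vk; have [S0 _] := has_sup_rayleigh_bounds sV hZ n.+1.
have [_ Sb] := has_sup_rayleigh_bounds sV hZ n.
have s0 : 0 <= sup (rayleigh_bounds V n).
  by apply: ub_le_sup => //; exact: rayleigh_bounds0.
apply: ge_sup => // a [a0 [g [gL ga]]].
apply/ler_addgt0Pr => e e0; rewrite -lerBlDr.
(* Below [k] the nonnegativity of the supremum is enough; above it, [a - e] can be lowered by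
   [k]. *)
have [aek|kae] := leP (a - e) k; first by rewrite (le_trans aek)// lerDr.
have ae0 : 0 < a - e := le_lt_trans k0 kae.
have [|h [hh hb]] := rayleigh_bound_perturb sV hZ (ltW ae0) _ gL ga.
  by rewrite gtrBl.
rewrite -lerBlDr; apply: ub_le_sup => //.
exact: rayleigh_bounds_shift_down ae0 (ltW kae) Vk hh hb.
Qed.

End Intertwining.

Theorem mainTheorem8 (R : realType) (V : R -> R)
  (hV : smooth V)
  (hZ : (\int[@lebesgue_measure R]_x (wgt V x)%:E < +oo)%E)
  (hconv : (0 < ereal_inf (range (fun x => (derive1 (derive1 V) x)%:E)))%E)
  (n : nat) (hn : (1 <= n)%N) :
  (ereal_inf (range (fun x => (derive1 (derive1 V) x)%:E))
     <= lambda V n - lambda V n.-1)%E /\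
  (lambda V n - lambda V n.-1
     <= ereal_sup (range (fun x => (derive1 (derive1 V) x)%:E)))%E.
Proof.
case: n hn => // n _; rewrite !(lambdaE hV hZ) -EFinB /=.
have inf_le x : (ereal_inf (range (fun x => (derive1 (derive1 V) x)%:E)) <=
    (derive1 (derive1 V) x)%:E)%E by apply: ereal_inf_lbound; exists x.
have le_sup x : ((derive1 (derive1 V) x)%:E <=
    ereal_sup (range (fun x => (derive1 (derive1 V) x)%:E)))%E.
  by apply: ereal_sup_ubound; exists x.
have V''_gt0 x : 0 < derive1 (derive1 V) x.
  by rewrite -lte_fin (lt_le_trans hconv).
split.
(* The infimum is at most the real number [V''(0)] and is positive, hence it is real. *)
- move: hconv inf_le; case: (ereal_inf _) => [k|_ /(_ 0)|//]; last by rewrite leNgt ltry.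
  rewrite !lte_fin => k0 kV; rewrite lee_fin lerBrDl.
  by apply: (sup_rayleigh_bounds_ge hV hZ _ (ltW k0)) => x; rewrite -lee_fin.
(* An infinite supremum leaves nothing to prove; a finite one is nonnegative since [V''(0) > 0]. *)
- move: le_sup; case: (ereal_sup _) => [k Vk||/(_ 0)//]; last by rewrite leey.
  rewrite lee_fin lerBlDl; apply: (sup_rayleigh_bounds_le hV hZ).
    by have := Vk 0; rewrite lee_fin; apply: le_trans; exact: ltW.
  by move=> x; rewrite -lee_fin.
Qed.
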